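(* Let $M$ be a closed smooth manifold, $F\colon M\to M$ a $C^1$-smooth map, and $\kappa\ge 1$ an integer such that $F^\kappa$ is non-degenerate. Let $I_\kappa(F)=\sum_{\text{good }\mathcal O} I(F^\kappa,\mathcal O)$ be the iterated index of $F$, the sum being over all good $\kappa$-periodic orbits $\mathcal O$ of $F$ (not necessarily with minimal period $\kappa$). Then $$I_\kappa(F)=\frac{1}{\kappa}\sum_{d\mid\kappa}\varphi(\kappa/d)\,I(F^d),$$ where $\varphi$ is the Euler function, the sum is over the positive divisors $d$ of $\kappa$, and $I(F^d)$ is the Lefschetz number of $F^d$.
   Context: A fixed point $x$ of a $C^1$ map $G\colon M\to M$ is non-degenerate if $1$ is not an eigenvalue of $DG_x\colon T_xM\to T_xM$; $G$ is non-degenerate if all its fixed points are. The index $I(G,x)$ of an isolated fixed point $x$ is the degree of the map $S^{n-1}\to S^{n-1}$, $z\mapsto (z-G(z))/\|z-G(z)\|$, with $z$ in a small sphere centered at $x$ in a local chart, $n=\dim M$. The Lefschetz number is $I(G)=\sum_{x\in \mathrm{Fix}(G)} I(G,x)$ when $G$ is non-degenerate (note that $F^d$ is non-degenerate for all $d\mid\kappa$ when $F^\kappa$ is). A $\kappa$-periodic point of $F$ is a fixed point $x$ of $F^\kappa$; its $\kappa$-periodic orbit is $\mathcal O=\{x,F(x),\dots,F^{\kappa-1}(x)\}$ (points not necessarily distinct). The minimal period $\tau$ of $x$ is the smallest positive integer with $F^\tau(x)=x$; then $\tau\mid\kappa$. All points of $\mathcal O$ have the same index as fixed points of $F^\kappa$,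 and $I(F^\kappa,\mathcal O):=I(F^\kappa,x)$ for any $x\in\mathcal O$. A periodic point $x$ of minimal period $\tau$ is even (odd) if the number of real eigenvalues, counted with algebraic multiplicity, of $DF^\tau_x$ in $(-\infty,-1)$ is even (odd). A $\kappa$-periodic point $x$ of minimal period $\tau$ is bad if $x$ is odd and $\kappa/\tau$ is even; otherwise it is good. A $\kappa$-periodic orbit is good (bad) if one, equivalently all, of its points are good (bad). $\varphi(m)$ is the number of positive integers smaller than $m$ and relatively prime to $m$, with $\varphi(1)=1$. *)

(* Defs.v *)
From HB Require Import structures.
From mathcomp Require Import all_boot all_order all_algebra.
From mathcomp Require Import all_classical all_reals all_analysis.

Set Implicit Arguments.
Unset Strict Implicit.
Unset Printing Implicit Defensive.

Import Order.TTheory GRing.Theory Num.Theory.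
Import numFieldNormedType.Exports.

Local Open Scope classical_set_scope.
Local Open Scope ring_scope.

(* f is of class C^k on the open set U; in finite dimension it suffices that
   every directional derivative be of class C^(k-1). *)
Fixpoint Ck (R : realType) (m n : nat) (k : nat) (U : set 'rV[R]_m)
    (f : 'rV[R]_m -> 'rV[R]_n) : Prop :=
  match k with
  | 0 => forall x, U x -> {for x, continuous f}
  | k'.+1 => (forall x, U x -> differentiable f x) /\
             (forall v, Ck k' U (fun x => 'd f x v))
  end.

(* The coordinate map and its inverse are total functions; only their values
   on chart_dom and chart_map @` chart_dom are meaningful. *)
Record chart (R : realType) (n : nat) (M : topologicalType) := Chart {
  chart_dom : set M;
  chart_map : M -> 'rV[R]_n;
  chart_inv : 'rV[R]_n -> M;
  chart_dom_open : open chart_dom;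
  chart_img_open : open (chart_map @` chart_dom);
  chart_mapK : forall x, chart_dom x -> chart_inv (chart_map x) = x;
  chart_map_continuous :
    forall x, chart_dom x -> {for x, continuous chart_map};
  chart_inv_continuous :
    forall z, (chart_map @` chart_dom) z -> {for z, continuous chart_inv}
}.

(* Charts are modelled on open subsets of R^n, so there is no boundary; second
   countability follows from compactness. *)
Record closedManifold (R : realType) (n : nat) := ClosedManifold {
  manifold_carrier :> topologicalType;
  atlas : set (chart R n manifold_carrier);
  manifold_hausdorff : hausdorff_space manifold_carrier;
  manifold_compact : compact [set: manifold_carrier];
  atlas_cover : forall x, exists2 c, atlas c & chart_dom c x;
  atlas_smooth : forall c c', atlas c -> atlas c' ->
    forall k, Ck k (chart_map c @` (chart_dom c `&` chart_dom c'))
                   (chart_map c' \o chart_inv c)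
}.

Definition C1_map (R : realType) (n : nat) (M : closedManifold R n)
    (F : M -> M) : Prop :=
  continuous F /\
  forall c c', atlas c -> atlas c' ->
    Ck 1 (chart_map c @` (chart_dom c `&` F @^-1` chart_dom c'))
         (chart_map c' \o F \o chart_inv c).

(* A preferred chart around each point. T_x M is identified with R^n through
   chart_at x; another choice of charts conjugates the matrix tangent_mx G x
   at a fixed point x of G. *)
Definition chart_at (R : realType) (n : nat) (M : closedManifold R n) (x : M) :
    chart R n M :=
  s2val (cid2 (atlas_cover x)).

(* The matrix, acting on row vectors, of DG_x : T_x M -> T_(G x) M. *)
Definition tangent_mx (R : realType) (n : nat) (M : closedManifold R n)
    (G : M -> M) (x : M) : 'M[R]_n :=
  jacobian (chart_map (chart_at (G x)) \o G \o chart_inv (chart_at x))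
           (chart_map (chart_at x) x).

Definition Fix (T : Type) (G : T -> T) : set T := [set x | G x = x].

Definition nondegenerate_map (R : realType) (n : nat) (M : closedManifold R n)
    (G : M -> M) : Prop :=
  forall x, Fix G x -> ~~ eigenvalue (tangent_mx G x) 1.

(* The norm of the library on 'rV[R]_n is the sup norm. *)
Definition enorm (R : realType) (n : nat) (z : 'rV[R]_n) : R :=
  Num.sqrt (\sum_i z 0 i ^+ 2).

Definition unit_sphere (R : realType) (n : nat) : set 'rV[R]_n :=
  [set u | enorm u = 1].

(* The positively homogeneous extension of a self-map f of S^(n-1). At a point
   u of the sphere its differential is df_u : T_u S -> T_(f u) S on the tangent
   space and sends the outward normal u to the outward normal f u. Hence its
   determinant is that of df_u in oriented orthonormal bases. *)
Definition radial_ext (R : realType) (n : nat) (f : 'rV[R]_n -> 'rV[R]_n)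
    (z : 'rV[R]_n) : 'rV[R]_n :=
  enorm z *: f ((enorm z)^-1 *: z).

Definition sphere_jacdet (R : realType) (n : nat)
    (f : 'rV[R]_n -> 'rV[R]_n) (u : 'rV[R]_n) : R :=
  \det (jacobian (radial_ext f) u).

Definition sphere_fiber (R : realType) (n : nat) (f : 'rV[R]_n -> 'rV[R]_n)
    (y : 'rV[R]_n) : set 'rV[R]_n :=
  [set u | unit_sphere u /\ f u = y].

Definition regular_value (R : realType) (n : nat) (f : 'rV[R]_n -> 'rV[R]_n)
    (y : 'rV[R]_n) : Prop :=
  unit_sphere y /\ forall u, sphere_fiber f y u -> sphere_jacdet f u != 0.

(* The degree of a C^1 map S^(n-1) -> S^(n-1), as the signed number of
   preimages of regular values: regular values exist by Sard's theorem and all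
   give the same number. For n = 0 the map of the empty sphere has degree 1, as
   in reduced homology. *)
Definition sphere_degree (R : realType) (n : nat) (f : 'rV[R]_n -> 'rV[R]_n) : int :=
  if n == 0%N then 1 else
  xget 0 [set k : int | forall y, regular_value f y ->
    \sum_(u \in sphere_fiber f y) sgz (sphere_jacdet f u) = k].

(* z |-> (z - g z) / |z - g z| on the sphere of center p and radius r,
   parametrized by the unit sphere. *)
Definition displacement_dir (R : realType) (n : nat)
    (g : 'rV[R]_n -> 'rV[R]_n) (p : 'rV[R]_n) (r : R) (u : 'rV[R]_n) :
    'rV[R]_n :=
  let z := p + r *: u in (enorm (z - g z))^-1 *: (z - g z).

(* For an isolated fixed point x of a C^1 map G; the degree does not depend on
   the radius once it is small, nor on the chart. *)
Definition fixed_point_index (R : realType) (n : nat) (M : closedManifold R n)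
    (G : M -> M) (x : M) : int :=
  let c := chart_at x in
  let g := chart_map c \o G \o chart_inv c in
  xget 0 [set k : int | \forall r \near (0 : R)^'+,
    sphere_degree (displacement_dir g (chart_map c x) r) = k].

Definition lefschetz (R : realType) (n : nat) (M : closedManifold R n)
    (G : M -> M) : int :=
  \sum_(x \in Fix G) fixed_point_index G x.

Definition is_min_period (T : Type) (F : T -> T) (x : T) (tau : nat) : Prop :=
  [/\ (0 < tau)%N, iter tau F x = x &
      forall m, (0 < m)%N -> iter m F x = x -> (tau <= m)%N].

(* The number of real eigenvalues of A in (-oo, -1), with multiplicity. *)
Definition nb_eigenvalues_ltN1 (R : realType) (n : nat) (A : 'M[R]_n) : nat :=
  \big[addn/0%N]_(a \in [set a | eigenvalue A a /\ a < -1])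
    mup a (char_poly A).

Definition odd_point (R : realType) (n : nat) (M : closedManifold R n)
    (F : M -> M) (tau : nat) (x : M) : Prop :=
  odd (nb_eigenvalues_ltN1 (tangent_mx (iter tau F) x)).

Definition bad_point (R : realType) (n : nat) (M : closedManifold R n)
    (F : M -> M) (kappa : nat) (x : M) : Prop :=
  exists tau, [/\ is_min_period F x tau, odd_point F tau x &
                  ~~ odd (kappa %/ tau)].

Definition periodic_orbit (T : Type) (F : T -> T) (kappa : nat) (x : T) :
    set T :=
  [set iter i F x | i in `I_kappa].

Definition good_orbits (R : realType) (n : nat) (M : closedManifold R n)
    (F : M -> M) (kappa : nat) : set (set M) :=
  [set O | exists x, [/\ Fix (iter kappa F) x, ~ bad_point F kappa x &
                         O = periodic_orbit F kappa x]].

(* The common index, as fixed points of G, of the points of O. *)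
Definition orbit_index (R : realType) (n : nat) (M : closedManifold R n)
    (G : M -> M) (O : set M) : int :=
  xget 0 [set k : int | forall x, O x -> fixed_point_index G x = k].

Definition iterated_index (R : realType) (n : nat) (M : closedManifold R n)
    (F : M -> M) (kappa : nat) : int :=
  \sum_(O \in good_orbits F kappa) orbit_index (iter kappa F) O.

(* Main.v *)
Require Import Defs.
From HB Require Import structures.
From mathcomp Require Import all_boot all_order all_algebra.
From mathcomp Require Import all_classical all_reals all_analysis.
From mathcomp Require Import cyclic complex polyrcf.
From mathcomp Require Import ring lra.

(** Near a non-degenerate fixed point p the displacement z - G(z) is C^1-close
    to the linear map 1 - DG_p, so on small spheres its direction is a
    diffeomorphism of the sphere and the index is the sign of det (1 - DG_p).
    For x of minimal period t and B = DF^t_x, the factorizations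
    1 - B^e = (1 - B) q(B) for e odd and 1 - B^e = (1 - B) (1 + B) q(B) for e
    even, with q a real polynomial without real roots, so that det q(B) >= 0,
    give I(F^(et), x) = s for e odd and s * eps for e even, where s is the sign
    of det (1 - B) and eps, the sign of det (1 + B), is -1 exactly when x is
    odd. Hence the sum over the divisors collects phi(k / e) with these signs
    at x, k = kappa / t: since phi summed over the divisors of k gives k, and
    over e even gives k / 2 when k is even, x contributes k I(F^kappa, x) if it
    is good and 0 if it is bad. An orbit has t = kappa / k points. *)

Set Implicit Arguments.
Unset Strict Implicit.
Unset Printing Implicit Defensive.
Import Order.TTheory GRing.Theory Num.Theory.
Import numFieldNormedType.Exports.
Local Open Scope classical_set_scope.
Local Open Scope ring_scope.

(** * Determinants of real matrix polynomials *)

(** The degree is pinned down only by the signed count over regular values, so the direction map on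
    a small sphere is shown to take every value exactly once, with one Jacobian sign throughout.
    Composed with the inverse of 1 - DG_p it is a perturbation of the identity, and the preimage of
    a point is the fixed point of a contraction of the sphere. A contraction asks for a Lipschitz
    bound on the error, not only for a bound on its size; this is why differentiability is used in a
    strict, two-point form, which the mean value theorem gives for C^1 maps and which passes to
    composites. The inequality det q(B) >= 0 comes from the complex roots a + ib of q: each real
    factor (X - a)^2 + b^2 contributes the squared modulus of a determinant. Since q may vanish at a
    complex eigenvalue of B, that det q(B) is nonzero has to come from the non-degeneracy of
    F^kappa. *)

(** Two block matrices are multiplied in both orders, and the products have the same determinant.
    The identity serves for a rank-one correction of a Jacobian and for the tangent maps at x and F
    x, which are [B *m A] and [A *m B]. *)
Lemma det_1addmxC (K : comNzRingType) (m n : nat) (A : 'M[K]_(m, n)) (B : 'M[K]_(n, m)) :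
  \det (1%:M + A *m B) = \det (1%:M + B *m A).
Proof.
have E1 : block_mx 1%:M (- A) B 1%:M *m block_mx 1%:M A 0 1%:M =
    block_mx 1%:M 0 B (1%:M + B *m A).
  rewrite mulmx_block !mulmx0 !mulmx1 !mul1mx !addr0; congr block_mx.
  - by rewrite addrN.
  - by rewrite addrC.
have E2 : block_mx 1%:M A 0 1%:M *m block_mx 1%:M (- A) B 1%:M =
    block_mx (1%:M + A *m B) 0 B 1%:M.
  rewrite mulmx_block !mul0mx !mulmx1 !mul1mx !add0r; congr block_mx.
  by rewrite addNr.
have := congr1 determinant E1; have := congr1 determinant E2.
rewrite !det_mulmx !det_lblock det_ublock !det1 !mul1r !mulr1 => -> //.
Qed.

(** As A and B commute, A^2 + B^2 = (A + iB)(A - iB); the second factor is the entrywise conjugate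
    of the first, so the determinant is a squared modulus. *)
Lemma det_sqrD_ge0 (R : rcfType) (n : nat) (A B : 'M[R]_n) :
  A *m B = B *m A -> 0 <= \det (A *m A + B *m B).
Proof.
move=> AB.
pose f := real_complex R : {rmorphism R -> R[i]}.
pose Ac := map_mx f A; pose Bc := map_mx f B.
pose C := Ac + 'i%C *: Bc.
have EC : map_mx f (A *m A + B *m B) = C *m map_mx (@conjc R) C.
  have -> : map_mx (@conjc R) C = Ac - 'i%C *: Bc.
    by apply/matrixP=> i j; rewrite !mxE /f /=; apply/eqP; rewrite eq_complex /=; apply/andP; split; apply/eqP; ring.
  rewrite mulmxBr !mulmxDl -!scalemxAl -!scalemxAr scalerA.
  rewrite map_mxD !map_mxM -/Ac -/Bc.
  have -> : Bc *m Ac = Ac *m Bc by rewrite -!map_mxM AB.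
  have -> : 'i%C * 'i%C = -1 :> R[i] by rewrite -expr2 sqr_i.
  rewrite scaleN1r; apply/matrixP=> i j; rewrite !mxE; ring.
have := congr1 determinant EC.
rewrite det_mulmx !det_map_mx /= => E.
have : 0 <= f (\det (A *m A + B *m B)).
  by rewrite /f /= E; case: (\det C) => a b; rewrite lecE /=; apply/andP; split; [apply/eqP; ring | nra].
by rewrite lecE /= eqxx.
Qed.

(** Induction on the size: a complex root a + ib of [p] has b nonzero, and the factor (X - a)^2 +
    b^2 that it splits off becomes at [B] a sum of two commuting squares. *)
Lemma det_horner_mx_ge0 (R : rcfType) (n : nat) (B : 'M[R]_n.+1) (p : {poly R}) :
  (forall x, 0 < p.[x]) -> 0 <= \det (horner_mx B p).
Proof.
move: {2}(size p) (leqnn (size p)) => k; elim: k p => [|k IH] p.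
  by rewrite leqn0 size_poly_eq0 => /eqP -> /(_ 0); rewrite horner0 ltxx.
move=> sp pp.
have [sp1|sp1] := leqP (size p) 1.
  rewrite (size1_polyC sp1) horner_mx_C det_scalar exprn_ge0 // ltW //.
  by have := pp 0; rewrite {1}(size1_polyC sp1) hornerC.
pose f := real_complex R : {rmorphism R -> R[i]}.
have /closed_rootP [z rz] : size (map_poly f p) != 1%N.
  by rewrite size_map_poly; apply: contraL sp1 => /eqP ->.
case: z rz => a b rz.
have fz : (a +i* b)%C = f a + 'i%C * f b.
  by rewrite [LHS]complexE.
have b0 : b != 0.
  apply/eqP=> b0; move: rz; rewrite fz b0 rmorph0 mulr0 addr0 fmorph_root.
  by rewrite rootE gt_eqF.
pose q : {poly R} := ('X - a%:P) ^+ 2 + (b ^+ 2)%:P.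
have Eq : q = ('X - a%:P) * ('X - a%:P) + b%:P * b%:P.
  by rewrite /q !expr2 polyCM.
have sq : size q = 3%N.
  rewrite /q size_polyDl size_exp_XsubC // size_polyC; by case: (_ != _).
have q0 : q != 0 by rewrite -size_poly_eq0 sq.
(* The remainder modulo [q] is real, of degree at most 1, and vanishes at a + ib; the imaginary part
   kills its slope, then the real part its constant term. *)
have qp : dvdp q p.
  have sr : (size (modp p q) <= 2)%N by rewrite -ltnS -sq ltn_modp.
  have : root (map_poly f (modp p q)) (a +i* b)%C.
    have := rz; rewrite {1}(divp_eq p q) rmorphD rmorphM /= !rootE hornerD hornerM.
    suff -> : (map_poly f q).[(a +i* b)%C] = 0 by rewrite mulr0 add0r.
    rewrite Eq rmorphD !rmorphM rmorphB /= map_polyX !map_polyC /=.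
    rewrite hornerD !hornerM !hornerE.
    by apply/eqP; rewrite eq_complex /=; apply/andP; split; apply/eqP; ring.
  rewrite /dvdp rootE => /eqP; set r := modp p q in sr *.
  rewrite (@horner_coef_wide _ 2) ?size_map_poly // !big_ord_recl big_ord0 !coef_map /=.
  rewrite expr0 expr1 mulr1 addr0 => E.
  have r1 : r`_1 = 0.
    have := congr1 (@complex.Im R) E; rewrite /= => H.
    apply/eqP; have : r`_1 * b = 0 by rewrite -[RHS]H; ring.
    by move/eqP; rewrite mulf_eq0 (negbTE b0) orbF.
  have r0 : r`_0 = 0.
    have := congr1 (@complex.Re R) E; rewrite /= r1 => H.
    by rewrite -[RHS]H; ring.
  apply/eqP/polyP=> i; rewrite coef0; case: i => [|[|i]] //.
  by rewrite nth_default // (leq_trans sr).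
have qx x : 0 < q.[x].
  rewrite /q !hornerE ltr_wpDl ?sqr_ge0 //.
  by rewrite exprn_even_gt0.
have Ep : p = (divp p q) * q by rewrite divpK.
rewrite {1}Ep rmorphM /= det_mulmx; apply: mulr_ge0.
  apply: IH.
    by rewrite size_divp // sq leq_subLR (leq_trans sp).
  move=> x; have := pp x; rewrite {1}Ep hornerM.
  by rewrite pmulr_lgt0.
rewrite Eq rmorphD !rmorphM /=; apply: det_sqrD_ge0.
exact: comm_horner_mx2.
Qed.

Lemma poly_split_roots (R : rcfType) (p : {poly R}) : p != 0 ->
  exists s : seq R, exists2 q : {poly R}, p = q * \prod_(a <- s) ('X - a%:P) &
    forall a, ~~ root q a.
Proof.
move: {2}(size p) (leqnn (size p)) => k; elim: k p => [|k IH] p.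
  by rewrite leqn0 size_poly_eq0 => ->.
move=> sp p0; have [[a ra]|nr] := pselect (exists a, root p a); last first.
  exists [::], p; first by rewrite big_nil mulr1.
  by move=> a; apply/negP => ra; apply: nr; exists a.
have /factor_theorem[q Eq] := ra.
have q0 : q != 0 by apply: contraNneq p0 => q0; rewrite Eq q0 mul0r.
have [|s [r Er nr]] := IH q _ q0.
  by move: sp; rewrite Eq size_Mmonic ?monicXsubC// size_XsubC addn2.
exists (a :: s), r => //; rewrite big_cons Eq Er.
by rewrite -!mulrA; congr (_ * _); rewrite mulrC.
Qed.

Lemma mup_split_roots (R : rcfType) (q : {poly R}) (s : seq R) (a : R) :
  (forall a, ~~ root q a) -> mup a (q * \prod_(a <- s) ('X - a%:P)) = count_mem a s.
Proof.
move=> nr; rewrite mupMr //; elim: s => [|b s IH].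
  by rewrite big_nil /= mupNroot // root1.
rewrite big_cons mupM ?polyXsubC_eq0 //; last first.
  by apply/monic_neq0/monic_prod_XsubC.
by rewrite IH -['X - _]expr1 mup_XsubCX /=; case: (b == a).
Qed.

(** Without real roots the sign is that of both infinities: 1 at plus infinity, as [q] is monic, and
    (-1)^deg at minus infinity. An odd size is an even degree. *)
Lemma monic_noroot_gt0 (R : rcfType) (q : {poly R}) : q \is monic ->
  (forall a, ~~ root q a) -> (forall x, 0 < q.[x]) /\ odd (size q).
Proof.
move=> mq nr.
have H x : Num.sg q.[x] = 1.
  rewrite (@sgp_pinftyP _ x q (fun y _ => nr y)) ?bound_in_itv//.
  by rewrite /sgp_pinfty (monicP mq) sgr1.
split=> [x|]; first by rewrite -sgr_cp0 H.
have := H 0; rewrite (@sgp_minftyP _ 0 q (fun y _ => nr y)) ?bound_in_itv//.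
rewrite /sgp_minfty (monicP mq) mulr1.
have : (0 < size q)%N by rewrite lt0n size_poly_eq0 monic_neq0.
case: (size q) => // k _; rewrite /= sgrX sgrN1 -signr_odd.
case: (odd k) => //= /eqP; rewrite expr1 eqNr oner_eq0 //.
Qed.

(** The exponent has the parity of the number of roots above [c], those that give a negative factor;
    it is written through the roots below [c], which is what gets counted for c = -1. *)
Lemma sgz_prod_XsubC (R : rcfType) (s : seq R) (c : R) : c \notin s ->
  sgz (\prod_(a <- s) ('X - a%:P)).[c] =
  (-1) ^+ (size s + count (fun a => a < c) s).
Proof.
elim: s => [|a s IH]; first by rewrite big_nil hornerC sgz1.
rewrite inE negb_or => /andP[ca cs]; rewrite big_cons hornerM sgzM IH //=.
rewrite hornerXsubC; case: ltgtP ca => // ac _ /=.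
  by rewrite gtr0_sgz ?subr_gt0// mul1r add1n addnS addSn !exprS mulrA mulrNN !mul1r.
by rewrite ltr0_sgz ?subr_lt0// add0n addSn exprS.
Qed.

Lemma horner_char_poly (K : comNzRingType) (n : nat) (A : 'M[K]_n) (a : K) :
  (char_poly A).[a] = \det (a%:M - A).
Proof.
rewrite /char_poly -horner_evalE -det_map_mx; congr (\det _); apply/matrixP=> i j.
by rewrite !mxE /= horner_evalE; case: eqP => _; rewrite !hornerE ?mulr1n ?mulr0n.
Qed.

(** The characteristic polynomial takes the value (-1)^n det (1 + B) at -1. Its factor without real
    roots is positive of even degree, so n has the parity of the number of real roots; the two
    parities cancel and only the roots below -1 remain. *)
Lemma sgz_det_1D (R : realType) (n : nat) (B : 'M[R]_n) :
  \det (1%:M + B) != 0 ->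
  sgz (\det (1%:M + B)) = (-1) ^+ nb_eigenvalues_ltN1 B.
Proof.
move=> d0; set p := char_poly B.
have Ep : p.[-1] = (-1) ^+ n * \det (1%:M + B).
  rewrite horner_char_poly -detZ; congr (\det _); apply/matrixP=> i j.
  by rewrite !mxE; case: eqP => _; rewrite ?mulr1n ?mulr0n; ring.
have p0 : p != 0 by apply/monic_neq0/char_poly_monic.
have [s [q Eq nr]] := poly_split_roots p0.
have mq : q \is monic.
  by have := char_poly_monic B; rewrite -/p Eq monicMr // monic_prod_XsubC.
have [qp oq] := monic_noroot_gt0 mq nr.
have sz : (size q + size s)%N = n.+1.
  have := size_char_poly B; rewrite -/p Eq size_Mmonic ?monic_neq0 ?monic_prod_XsubC//.
  by rewrite size_prod_XsubC addnS.
have Ns : -1 \notin s.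
  apply: contraNN d0 => ms; have : p.[-1] == 0.
    rewrite Eq hornerM mulf_eq0; apply/orP; right; rewrite -rootE.
    by rewrite root_prod_XsubC.
  by rewrite Ep mulf_eq0 signr_eq0.
have -> : \det (1%:M + B) = (-1) ^+ n * p.[-1] by rewrite Ep signrMK.
rewrite Eq hornerM !sgzM (gtr0_sgz (qp _)) mul1r sgz_prod_XsubC //.
rewrite sgzX sgzN1 -exprD.
have -> : nb_eigenvalues_ltN1 B = count (fun a => a < -1) s.
  (* The sum runs over the distinct entries of [s] below -1, and the multiplicity of each is its
     number of occurrences in [s]. *)
  rewrite /nb_eigenvalues_ltN1 (@fsbig_fwiden _ _ _ _ (undup (seq.filter (fun a => a < -1) s))).
  - rewrite -size_filter; set t := seq.filter _ s.
    rewrite (eq_big_seq (fun a => count_mem a t)).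
      rewrite -(perm_size (perm_count_undup t)) size_flatten /shape -map_comp.
      by rewrite sumnE big_map; apply: eq_bigr => a _; rewrite /= size_nseq.
    move=> a; rewrite mem_undup => at_; rewrite -/p Eq mup_split_roots // /t count_filter.
    apply: eq_count => b /=; case: eqP => //= ->.
    by move: at_; rewrite mem_filter => /andP[->].
  - move=> a [] /=; rewrite eigenvalue_root_char -/p Eq rootM (negbTE (nr _)) /= root_prod_XsubC.
    by move=> as_ a1; rewrite mem_undup mem_filter as_ a1.
  - exact: undup_uniq.
  - move=> a [] /=; rewrite mem_undup mem_filter => /andP[a1 as_] [].
    by rewrite eigenvalue_root_char -/p Eq rootM (negbTE (nr _)) /= root_prod_XsubC as_.
rewrite -(signr_odd _ (n + _)) -[RHS]signr_odd !oddD.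
have : odd n = ~~ (odd (size q + size s)) by rewrite sz /= negbK.
rewrite oddD oq => ->; by case: (odd (size s)); case: (odd _).
Qed.

(** The cofactor 1 + X + ... + X^(m-1) is positive on the reals: clearly so for x >= 0, and for x <
    0 because (1 - x) p(x) = 1 - x^m > 0 when m is odd. *)
Lemma sgz_det_1B_odd (R : rcfType) (n : nat) (B : 'M[R]_n) (m : nat) : odd m ->
  \det (1%:M - B ^+ m) != 0 ->
  sgz (\det (1%:M - B ^+ m)) = sgz (\det (1%:M - B)).
Proof.
case: n B => [|n] B om; first by rewrite !det_mx00.
pose p : {poly R} := \sum_(i < m) 'X^i.
have Ep : 1 - 'X^m = (1 - 'X) * p :> {poly R} by rewrite -[in LHS](expr1n _ m) subrXX; congr (_ * _); apply: eq_bigr => i _; rewrite expr1n mul1r.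
have pp x : 0 < p.[x].
  have E : 1 - x ^+ m = (1 - x) * p.[x].
    by have := congr1 (horner^~ x) Ep; rewrite hornerM !hornerE.
  have [x0|x0] := leP 0 x.
    rewrite horner_sum; case: {+}m om => // k _; rewrite big_ord_recl !hornerE /= ltr_pwDl //.
    by apply: sumr_ge0 => i _; rewrite hornerXn exprn_ge0.
  have x1 : 0 < 1 - x by lra.
  rewrite -(pmulr_rgt0 _ x1) -E subr_gt0 (lt_trans _ ltr01) //.
  by rewrite exprn_odd_lt0.
have := congr1 (fun q => \det (horner_mx B q)) Ep.
rewrite rmorphM !rmorphB /= rmorph1 rmorphXn /= horner_mx_X => E.
rewrite E det_mulmx mulf_eq0 negb_or => /andP[d1 d2].
rewrite sgzM [X in _ * X]gtr0_sgz ?mulr1 //.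
by rewrite lt_neqAle eq_sym d2 det_horner_mx_ge0.
Qed.

(** Here 1 - X^m is (1 - X)(1 + X) times 1 + X^2 + ... + X^(m-2), a polynomial in X^2 with positive
    values. *)
Lemma sgz_det_1B_even (R : rcfType) (n : nat) (B : 'M[R]_n) (m : nat) : ~~ odd m ->
  \det (1%:M - B ^+ m) != 0 ->
  sgz (\det (1%:M - B ^+ m)) = sgz (\det (1%:M - B)) * sgz (\det (1%:M + B))
  /\ \det (1%:M + B) != 0.
Proof.
case: n B => [|n] B om; first by rewrite !det_mx00 sgz1 mulr1 oner_eq0.
pose k := m./2.
have mk : m = (2 * k)%N by rewrite mul2n even_halfK.
pose p : {poly R} := \sum_(i < k) ('X^2) ^+ i.
have Ep : 1 - 'X^m = (1 - 'X) * (1 + 'X) * p :> {poly R}.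
  rewrite mk exprM -[in LHS](expr1n _ k) subrXX; congr (_ * _); first by ring.
  apply: eq_bigr => i _; by rewrite expr1n mul1r.
have pp x : (0 < k)%N -> 0 < p.[x].
  rewrite horner_sum => k0; rewrite -(prednK k0) big_ord_recl !hornerE /= ltr_pwDl //.
  by apply: sumr_ge0 => i _; rewrite !hornerE exprn_ge0 // sqr_ge0.
have := congr1 (fun q => \det (horner_mx B q)) Ep.
rewrite !rmorphM !rmorphB rmorphD /= rmorph1 rmorphXn /= horner_mx_X => E.
rewrite E !det_mulmx !mulf_eq0 !negb_or => /andP[/andP[d1 d3] d2].
split=> //; rewrite !sgzM [X in _ * X]gtr0_sgz ?mulr1 //.
rewrite lt_neqAle eq_sym d2 det_horner_mx_ge0 // => x; apply: pp.
(* For m = 0 the cofactor would be the zero polynomial, against det p(B) being nonzero. *)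
rewrite lt0n; apply: contraNneq d2 => k0; rewrite /p k0 big_ord0 rmorph0 det0 //.
Qed.

(** * Differential of a normalized map *)

Section NormalizedMaps.
Context {R : realType}.

Lemma is_diff_scale_prod (V W : normedModType R) (s : V -> R) (ds : V -> R)
    (f df : V -> W) (x : V) :
  is_diff x s ds -> is_diff x f df ->
  is_diff x (fun z => s z *: f z) (fun h => ds h *: f x + s x *: df h).
Proof.
move=> dsx dfx.
have bil : bilinear_for
    (GRing.Scale.Law.clone _ _ *:%R _) (GRing.Scale.Law.clone _ _ *:%R _)
    (@GRing.scale R W).
  split=> [u'|u] a y z /=; first by rewrite scalerDl !scalerA.
  by rewrite scalerDr !scalerA mulrC.
pose bm := bilinear_isBilinear.Build R R W W _ _ (@GRing.scale R W) bil.
pose B : {bilinear R -> W -> W} := HB.pack (@GRing.scale R W) bm.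
have cB : continuous (fun p : R * W => B p.1 p.2) by move=> p; exact: scale_continuous.
have dB (p : R * W) : is_diff p (fun q : R * W => q.1 *: q.2) (fun q : R * W => p.1 *: q.2 + q.1 *: p.2).
  by apply: DiffDef; [exact: (@differentiable_bilin _ _ _ _ B)|exact: (@diff_bilin _ _ _ _ B)].
have dp := is_diff_pair dsx dfx.
apply: (@is_diff_eq _ _ _ _ _ _ _ (is_diff_comp dp (dB (s x, f x)))).
by apply/funext => h /=; rewrite addrC.
Qed.

Lemma is_diff_coord (n : nat) (x : 'rV[R]_n) j :
  is_diff x (fun z : 'rV[R]_n => z 0 j : R) (fun z : 'rV[R]_n => z 0 j : R).
Proof.
have @f : {linear 'rV[R]_n -> R}.
  by exists (fun N : 'rV[R]_n => N 0 j); do 2![eexists]; do ?[constructor];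
     rewrite ?mxE// => ? *; rewrite ?mxE//; move=> ?; rewrite !mxE.
apply: DiffDef; first exact: differentiable_coord.
by rewrite (@diff_lin _ _ _ f) //; exact/coord_continuous.
Qed.

Lemma is_diff_bigsum (V W : normedModType R) (I : Type) (r : seq I) (f df : I -> V -> W) (x : V) :
  (forall i, is_diff x (f i) (df i)) ->
  is_diff x (fun z => \sum_(i <- r) f i z) (fun h => \sum_(i <- r) df i h).
Proof.
move=> H; elim: r => [|i r IH].
  have -> : (fun z => \sum_(i <- [::]) f i z) = cst 0 by apply/funext => z; rewrite big_nil.
  apply: is_diff_eq; apply/funext => z; rewrite big_nil //.
have -> : (fun z => \sum_(i <- i :: r) f i z) = f i + (fun z => \sum_(i <- r) f i z).
  by apply/funext => z; rewrite big_cons.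
apply: is_diff_eq; apply/funext => z; rewrite big_cons //.
Qed.

Definition dotr (n : nat) (u v : 'rV[R]_n) : R := \sum_i u 0 i * v 0 i.

Lemma dotrE (n : nat) (u v : 'rV[R]_n) : u *m v^T = (dotr u v)%:M.
Proof.
apply/matrixP=> i j; rewrite !ord1 !mxE eqxx mulr1n; apply: eq_bigr => k _.
by rewrite mxE.
Qed.

Lemma dotrC (n : nat) (u v : 'rV[R]_n) : dotr u v = dotr v u.
Proof. by apply: eq_bigr => i _; rewrite mulrC. Qed.

Lemma enormE (n : nat) (u : 'rV[R]_n) : enorm u = Num.sqrt (dotr u u).
Proof. by []. Qed.

Lemma dotr_ge0 (n : nat) (u : 'rV[R]_n) : 0 <= dotr u u.
Proof. by apply: sumr_ge0 => i _; rewrite -expr2 sqr_ge0. Qed.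

Lemma enorm_ge0 (n : nat) (u : 'rV[R]_n) : 0 <= enorm u.
Proof. exact: sqrtr_ge0. Qed.

Lemma sqr_enorm (n : nat) (u : 'rV[R]_n) : enorm u ^+ 2 = dotr u u.
Proof. by rewrite enormE sqr_sqrtr // dotr_ge0. Qed.

Lemma enorm_gt0 (n : nat) (u : 'rV[R]_n) : (0 < enorm u) = (u != 0).
Proof.
rewrite enormE sqrtr_gt0 lt_neqAle dotr_ge0 andbT eq_sym; congr (~~ _).
rewrite psumr_eq0 => [|i _]; last by rewrite -expr2 sqr_ge0.
apply/allP/eqP => [H|-> i _]; last by rewrite /= mxE mulr0 eqxx.
apply/rowP => i; rewrite mxE; apply/eqP.
by have := H i (mem_index_enum _); rewrite /= mulf_eq0 orbb.
Qed.

Lemma enormZ (n : nat) (a : R) (u : 'rV[R]_n) : enorm (a *: u) = `|a| * enorm u.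
Proof.
rewrite !enormE (_ : dotr (a *: u) (a *: u) = a ^+ 2 * dotr u u).
  by rewrite sqrtrM ?sqr_ge0 // sqrtr_sqr.
by rewrite /dotr mulr_sumr; apply: eq_bigr => i _; rewrite !mxE; ring.
Qed.

Lemma is_diff_enorm (V : normedModType R) (n : nat) (f df : V -> 'rV[R]_n) (x : V) :
  f x != 0 -> is_diff x f df ->
  is_diff x (fun z => enorm (f z)) (fun h => (enorm (f x))^-1 * dotr (f x) (df h)).
Proof.
move=> fx0 dfx.
have d2 : is_diff x (fun z => dotr (f z) (f z)) (fun h => 2 * dotr (f x) (df h)).
  rewrite /dotr.
  have dc i : is_diff x (fun z => f z 0 i : R) (fun h => df h 0 i : R).
    by apply: (is_diff_comp dfx (is_diff_coord (f x) i)).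
  have := @is_diff_bigsum _ R^o _ (index_enum 'I_n) _ _ x (fun i => is_diffM (dc i) (dc i)).
  move/is_diff_eq; apply; apply/funext => h; rewrite mulr_sumr.
  apply: eq_bigr => i _; rewrite -[LHS]/(f x 0 i * df h 0 i + f x 0 i * df h 0 i); ring.
have p0 : 0 < dotr (f x) (f x) by rewrite -sqr_enorm exprn_gt0 // enorm_gt0.
have ds : is_diff (dotr (f x) (f x)) (Num.sqrt : R -> R)
    (fun h => (2 * enorm (f x))^-1 * h).
  have D := is_derive1_sqrt p0.
  have dd : differentiable (Num.sqrt : R -> R) (dotr (f x) (f x)).
    by apply/derivable1_diffP; exact: ex_derive.
  apply: DiffDef => //; apply/funext => h.
  rewrite -[h]mulr1 -[h * 1]/(h *: (1 : R)) linearZ /= -deriveE // derive_val.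
  by rewrite -[RHS]/((2 * enorm (f x))^-1 * (h * 1)) mulr1; exact: mulrC.
apply: (@is_diff_eq _ _ _ _ _ _ _ (is_diff_comp d2 ds)).
apply/funext => h /=; rewrite invfM; field.
by rewrite gt_eqF // enorm_gt0.
Qed.

Lemma is_diff_inv (V : normedModType R) (f df : V -> R) (x : V) : f x != 0 ->
  is_diff x f df -> is_diff x (fun z => (f z)^-1) (fun h => - (f x) ^- 2 * df h).
Proof.
move=> fx0 dfx; apply: DiffDef; first exact: differentiableV.
by rewrite diffV // diff_val.
Qed.

(** The differential is [df] projected orthogonally to [f x] and divided by the norm of [f x]. *)
Lemma is_diff_normalize (V : normedModType R) (n : nat) (f df : V -> 'rV[R]_n) (x : V) :
  f x != 0 -> is_diff x f df ->
  is_diff x (fun z => (enorm (f z))^-1 *: f z)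
    (fun h => (enorm (f x))^-1 *: df h -
       ((enorm (f x)) ^- 3 * dotr (f x) (df h)) *: f x).
Proof.
move=> f0 dfx; have e0 : enorm (f x) != 0 by rewrite gt_eqF // enorm_gt0.
have d1 := @is_diff_inv V (fun z => enorm (f z)) _ x e0 (is_diff_enorm f0 dfx).
have := is_diff_scale_prod d1 dfx.
move/is_diff_eq; apply; apply/funext => h; rewrite addrC -scaleNr; congr (_ + _ *: _).
by field.
Qed.

Lemma jacobianE (m n : nat) (f : 'rV[R]_m -> 'rV[R]_n) x df (A : 'M[R]_(m, n)) :
  is_diff x f df -> (forall v, df v = v *m A) -> jacobian f x = A.
Proof.
move=> dfx dfE; apply/row_matrixP => i; rewrite !rowE /jacobian mul_rV_lin1 -dfE.
by rewrite diff_val.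
Qed.

Lemma is_diff_jacobian (m n : nat) (f : 'rV[R]_m -> 'rV[R]_n) x :
  differentiable f x -> is_diff x f (fun v => v *m jacobian f x).
Proof. by move=> df; apply: DiffDef => //; apply/funext => v; rewrite /jacobian mul_rV_lin1. Qed.

(** The matrix under the determinant agrees with [K] on vectors tangent to the sphere at [u] and
    sends [u] to [H u]. Normalizing divides it by the norm of [H u] and adds multiples of [H u] to
    the images of tangent vectors, which leaves the determinant unchanged. *)
Lemma sphere_jacdet_normalize (n : nat) (H : 'rV[R]_n -> 'rV[R]_n) (u : 'rV[R]_n)
    (K : 'M[R]_n) :
  enorm u = 1 -> H u != 0 -> is_diff u H (fun v => v *m K) ->
  sphere_jacdet (fun z => (enorm (H z))^-1 *: H z) u =
  (enorm (H u)) ^- n * \det (K + u^T *m (H u - u *m K)).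
Proof.
move=> u1 H0 dH; set f := fun z => _.
have u0 : u != 0 by rewrite -enorm_gt0 u1.
have e0 : enorm (H u) != 0 by rewrite gt_eqF // enorm_gt0.
set e := enorm (H u) in e0 *.
have df := is_diff_normalize H0 dH.
have dN := is_diff_enorm u0 (is_diff_id u).
have ds := is_diff_normalize u0 (is_diff_id u).
have Eu : (enorm (id u))^-1 *: id u = u by rewrite u1 invr1 scale1r.
rewrite -[X in is_diff X f _]Eu in df.
have dr := is_diff_scale_prod dN (is_diff_comp ds df).
pose fu := e^-1 *: H u.
have uu : u *m u^T = 1%:M by rewrite dotrE -sqr_enorm u1 expr1n.
pose P := 1%:M - u^T *m u.
(* The Jacobian matrix is (1 - b u) K' / e, and det (1 - b u) = 1 because u b = 0. *)
pose b := e^-1 *: (P *m K *m fu^T).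
pose K' := K + u^T *m (H u - u *m K).
have uP : u *m P = 0 by rewrite mulmxBr mulmx1 mulmxA uu mul1mx subrr.
have uK' : u *m K' = H u by rewrite mulmxDr mulmxA uu mul1mx addrC subrK.
have PK' : P *m K + u^T *m H u = K'.
  rewrite mulmxBl mul1mx /K' mulmxBr mulmxA addrA addrAC //.
rewrite /sphere_jacdet (@jacobianE _ _ _ _ _ ((1%:M - b *m u) *m (e^-1 *: K')) dr).
  rewrite det_mulmx detZ -exprVn -mulNmx det_1addmxC mulmxN -scalemxAr !mulmxA uP !mul0mx.
  by rewrite scaler0 oppr0 addr0 det1 mul1r.
move=> v /=.
rewrite u1 invr1 !mul1r !scale1r -/e.
have -> : (1 ^- 3 * dotr u v) *: u = v *m u^T *m u.
  by rewrite dotrE mul_scalar_mx expr1n invr1 mul1r dotrC.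
have -> : v - v *m u^T *m u = v *m P by rewrite mulmxBr mulmx1 mulmxA.
rewrite mulmxBl mul1mx -!mulmxA -!scalemxAr uK' mulmxBr -!scalemxAr.
rewrite -PK' mulmxDr scalerDr.
have -> : dotr u v *: f u = e^-1 *: (v *m (u^T *m H u)).
  by rewrite /f -/e mulmxA dotrE mul_scalar_mx !scalerA dotrC mulrC.
rewrite [RHS]addrAC addrC !mulmxA; congr (_ + _).
have -> : v *m b = (e^-1 * (e^-1 * dotr (H u) (v *m P *m K)))%:M.
  by rewrite /b /fu !linearZ /= !linearZ /= !mulmxA dotrE !scale_scalar_mx dotrC.
rewrite mul_scalar_mx scalerA; congr (_ - _ *: _); field.
exact: e0.
Qed.
End NormalizedMaps.

(** * Perturbations of the identity on the sphere *)

(** Makes completeness available together with the norm on row vectors, for the Banach fixed-point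
    theorem. *)
HB.instance Definition _ (R : realType) (n : nat) := Complete.on ('rV[R]_n).

Section SphereNearId.
Context {R : realType}.

Lemma ler_coord_norm (n : nat) (v : 'rV[R]_n) j : `|v 0 j| <= `|v|.
Proof.
rewrite [leRHS]/Num.Def.normr /= mx_normrE.
by apply/bigmax_geP; right => /=; exists (0, j).
Qed.

Lemma rV_norm_le (n : nat) (v : 'rV[R]_n) (c : R) :
  0 <= c -> (forall j, `|v 0 j| <= c) -> `|v| <= c.
Proof.
move=> c0 H; rewrite [leLHS]/Num.Def.normr /= mx_normrE.
by apply/bigmax_leP; split => // -[i j] _ /=; rewrite ord1.
Qed.

Lemma norm_mulmx_bound (m n : nat) (A : 'M[R]_(m, n)) :
  exists2 C, 0 < C & forall v : 'rV[R]_m, `|v *m A| <= C * `|v|.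
Proof.
(* The summand 1 keeps the constant positive when [A] is zero. *)
exists (1 + \sum_i \sum_j `|A i j|) => [|v].
  by rewrite ltr_pwDl // sumr_ge0 // => i _; rewrite sumr_ge0.
apply: rV_norm_le => [|j].
  by rewrite mulr_ge0 // addr_ge0 // sumr_ge0 // => i _; rewrite sumr_ge0.
rewrite mxE (le_trans (ler_norm_sum _ _ _)) // mulrDl mul1r mulr_suml.
apply: (@le_trans _ _ (\sum_i (\sum_j `|A i j|) * `|v|)); last by rewrite lerDr.
apply: ler_sum => i _; rewrite normrM mulrC ler_pM // ?ler_coord_norm //.
by rewrite (bigD1 j) //= lerDl sumr_ge0.
Qed.

Lemma norm_le_enorm (n : nat) (v : 'rV[R]_n) : `|v| <= enorm v.
Proof.
apply: rV_norm_le => [|j]; first exact: enorm_ge0.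
rewrite -sqrtr_sqr enormE ler_wsqrtr // /dotr (bigD1 j) //= expr2 lerDl.
by apply: sumr_ge0 => i _; rewrite -expr2 sqr_ge0.
Qed.

Lemma dotrBr (n : nat) (w u v : 'rV[R]_n) : dotr w (u - v) = dotr w u - dotr w v.
Proof. by rewrite /dotr -sumrB; apply: eq_bigr => i _; rewrite !mxE mulrBr. Qed.

Lemma dotrBl (n : nat) (w u v : 'rV[R]_n) : dotr (u - v) w = dotr u w - dotr v w.
Proof. by rewrite ![dotr _ w]dotrC dotrBr. Qed.

Lemma dotrZr (n : nat) (w u : 'rV[R]_n) a : dotr w (a *: u) = a * dotr w u.
Proof. by rewrite /dotr mulr_sumr; apply: eq_bigr => i _; rewrite !mxE; ring. Qed.

Lemma dotrZl (n : nat) (w u : 'rV[R]_n) a : dotr (a *: u) w = a * dotr u w.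
Proof. by rewrite dotrC dotrZr dotrC. Qed.

(** The norm on the right is the sup norm, whence the factor n; it reappears in the constant of
    [sphere_near_id]. *)
Lemma dotr_le (n : nat) (u v : 'rV[R]_n) : `|dotr u v| <= n%:R * `|u| * `|v|.
Proof.
rewrite /dotr (le_trans (ler_norm_sum _ _ _)) //.
rewrite -mulrA mulr_natl -[X in _ *+ X]card_ord -sumr_const.
by apply: ler_sum => i _; rewrite normrM ler_pM // ler_coord_norm.
Qed.

Lemma closed_unit_sphere (n : nat) : closed (@unit_sphere R n).
Proof.
have -> : @unit_sphere R n = (fun u : 'rV[R]_n => dotr u u) @^-1` [set 1].
  apply/seteqP; split=> u; rewrite /unit_sphere /= -sqr_enorm.
    by move=> ->; rewrite expr1n.
  by move/eqP; rewrite sqrp_eq1 ?enorm_ge0 // => /eqP.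
have c : continuous (fun u : 'rV[R]_n => dotr u u).
  rewrite /dotr; apply: continuous_big => [|i _ x]; first exact: add_continuous.
  by apply: (@continuousM _ _ (fun u : 'rV[R]_n => u 0 i)); apply: coord_continuous.
by apply: preimage_closed => [u _|]; [exact: c|exact: closed_eq].
Qed.

(* Solves |t w - v| = 1 with t > 0. *)
Let tsol (n : nat) (w v : 'rV[R]_n) :=
  dotr w v + Num.sqrt (1 - dotr v v + dotr w v ^+ 2).

Lemma half_le_sqrtr (x : R) : 4^-1 <= x -> 2^-1 <= Num.sqrt x.
Proof.
move=> x4; have -> : 2^-1 = Num.sqrt (4^-1) :> R.
  rewrite (_ : 4^-1 = 2^-1 ^+ 2 :> R); last by field.
  by rewrite sqrtr_sqr ger0_norm // invr_ge0.
exact: ler_wsqrtr.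
Qed.

(** Both roots are at least 1/2, so their sum, by which a - b is divided, is at least 1. *)
Lemma sqrtr_lipschitz (a b : R) : 4^-1 <= a -> 4^-1 <= b ->
  `|Num.sqrt a - Num.sqrt b| <= `|a - b|.
Proof.
move=> a4 b4.
have a0 : 0 <= a by lra.
have b0 : 0 <= b by lra.
have := half_le_sqrtr a4; have := half_le_sqrtr b4 => hb ha.
rewrite -{2}(sqr_sqrtr a0) -{2}(sqr_sqrtr b0) subr_sqr normrM ler_peMr //.
by rewrite ger0_norm; lra.
Qed.

(** The bound n k <= 1/4 keeps every scalar product with [v] within 1/4, so the radicand stays above
    1/2, where the square root is 1-Lipschitz. The linear term has Lipschitz constant n and the root
    n + 1/2; 2n + 2 is a rounder bound. *)
Lemma tsol_lipschitz (n : nat) (w v v' : 'rV[R]_n) (k : R) :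
  enorm w = 1 -> 0 < k -> n%:R * k <= 4^-1 -> k <= 1 -> `|v| <= k -> `|v'| <= k ->
  [/\ 0 < tsol w v,
      `|tsol w v - tsol w v'| <= (2 * n%:R + 2) * `|v - v'|,
      2^-1 <= 1 - dotr v v + dotr w v ^+ 2 &
      `|dotr w v| <= 4^-1].
Proof.
move=> w1 k0 nk k1 vk v'k.
have w1' : `|w| <= 1 by rewrite -w1 norm_le_enorm.
have n0 : 0 <= n%:R :> R by [].
have dw (x : 'rV[R]_n) : `|x| <= k -> `|dotr w x| <= 4^-1.
  move=> xk; rewrite (le_trans (dotr_le _ _)) // (le_trans _ nk) //.
  rewrite -mulrA ler_wpM2l // -[leRHS]mul1r ler_pM //.
have dx (x : 'rV[R]_n) : `|x| <= k -> 0 <= dotr x x <= 4^-1.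
  move=> xk; rewrite dotr_ge0 (le_trans (ler_norm _)) // (le_trans (dotr_le _ _)) //.
  by rewrite (le_trans _ nk) // -mulrA ler_wpM2l // -[leRHS]mul1r ler_pM // (le_trans xk).
have av (x : 'rV[R]_n) : `|x| <= k -> 2^-1 <= 1 - dotr x x + dotr w x ^+ 2.
  by move=> /dx /andP[_ h]; have := sqr_ge0 (dotr w x); lra.
split; [| | exact: av | exact: dw].
  have : 2^-1 <= Num.sqrt (1 - dotr v v + dotr w v ^+ 2).
    by apply: half_le_sqrtr; have := av _ vk; lra.
  by have := dw _ vk; rewrite /tsol ler_norml => /andP[]; lra.
pose D := `|v - v'|.
have d1 : `|dotr w v - dotr w v'| <= n%:R * D.
  by rewrite -dotrBr (le_trans (dotr_le _ _)) // -mulrA ler_wpM2l // -[leRHS]mul1r ler_pM.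
have dD (x : 'rV[R]_n) : `|x| <= k -> `|dotr x (v - v')| <= 4^-1 * D.
  move=> xk; rewrite (le_trans (dotr_le _ _)) // ler_wpM2r // (le_trans _ nk) //.
  by rewrite ler_wpM2l.
have d2 : `|dotr v v - dotr v' v'| <= 2^-1 * D.
  rewrite (_ : _ - _ = dotr v (v - v') + dotr v' (v - v')); last first.
    by rewrite !dotrBr [dotr v' v]dotrC; ring.
  by rewrite (le_trans (ler_normD _ _)) //; have := dD _ vk; have := dD _ v'k; lra.
have d3 : `|dotr w v ^+ 2 - dotr w v' ^+ 2| <= n%:R * D.
  rewrite subr_sqr normrM -[leRHS]mulr1 ler_pM //.
  by rewrite (le_trans (ler_normD _ _)) //; have := dw _ vk; have := dw _ v'k; lra.
have D0 : 0 <= D by rewrite /D.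
have d4 := @sqrtr_lipschitz (1 - dotr v v + dotr w v ^+ 2) (1 - dotr v' v' + dotr w v' ^+ 2).
have {}d4 := d4 (le_trans _ (av _ vk)) (le_trans _ (av _ v'k)).
have {}d4 : `|Num.sqrt (1 - dotr v v + dotr w v ^+ 2) - Num.sqrt (1 - dotr v' v' + dotr w v' ^+ 2)| <= 2^-1 * D + n%:R * D.
  apply: le_trans (d4 _ _) _; [lra|lra|].
  rewrite (_ : _ - _ = (dotr w v ^+ 2 - dotr w v' ^+ 2) - (dotr v v - dotr v' v')); last by ring.
  by rewrite (le_trans (ler_normB _ _)) //; lra.
rewrite /tsol -/D opprD addrACA; apply: le_trans (ler_normD _ _) _.
have nD : 0 <= n%:R * D by exact: mulr_ge0.
by apply: le_trans (lerD d1 d4) _; lra.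
Qed.

Lemma tsol_enorm (n : nat) (w v : 'rV[R]_n) (k : R) :
  enorm w = 1 -> 0 < k -> n%:R * k <= 4^-1 -> k <= 1 -> `|v| <= k ->
  enorm (tsol w v *: w - v) = 1.
Proof.
move=> w1 k0 nk k1 vk; have [_ _ a0 _] := tsol_lipschitz w1 k0 nk k1 vk vk.
rewrite enormE (_ : dotr (_ - _) (_ - _) = 1) ?sqrtr1 //.
rewrite dotrBl !dotrBr !dotrZl !dotrZr [dotr v w]dotrC -(sqr_enorm w) w1 expr1n.
rewrite /tsol; set b := dotr w v; set a := 1 - _ + _.
have := sqr_sqrtr (le_trans (_ : 0 <= 2^-1) a0).
by rewrite -/b -/a invr_ge0 ler0n => /(_ isT) Ea; rewrite /a in Ea *; lra.
Qed.

(** The number t is a root of a quadratic with roots b - sqrt a and b + sqrt a; the first is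
    negative since b <= 1/4 and sqrt a >= 1/2. *)
Lemma tsol_uniq (n : nat) (w v u : 'rV[R]_n) (k t : R) :
  enorm w = 1 -> 0 < k -> n%:R * k <= 4^-1 -> k <= 1 -> `|v| <= k ->
  enorm u = 1 -> 0 < t -> u + v = t *: w -> t = tsol w v.
Proof.
move=> w1 k0 nk k1 vk u1 t0 E; have [_ _ a0 _] := tsol_lipschitz w1 k0 nk k1 vk vk.
have ww : dotr w w = 1 by rewrite -sqr_enorm w1 expr1n.
have Eu : dotr u u = 1 by rewrite -sqr_enorm u1 expr1n.
have {E} Eu' : u = t *: w - v by rewrite -E addrK.
move: Eu; rewrite Eu' dotrBl !dotrBr !dotrZl !dotrZr [dotr v w]dotrC ww.
rewrite /tsol; set b := dotr w v; set a := 1 - _ + _ => Eu.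
have [_ _ _ b4] := tsol_lipschitz w1 k0 nk k1 vk vk.
have a4 : 2^-1 <= Num.sqrt a by apply: half_le_sqrtr; rewrite -/b -/a in a0; lra.
have Ea : Num.sqrt a ^+ 2 = a by rewrite sqr_sqrtr // -[a]/a; rewrite -/b -/a in a0; lra.
have : (t - b - Num.sqrt a) * (t - b + Num.sqrt a) = 0.
  by rewrite -subr_sqr Ea /a; lra.
move/eqP; rewrite mulf_eq0 => /orP[/eqP|/eqP H]; first by lra.
by move: b4; rewrite -/b ler_norml => /andP[]; lra.
Qed.

(** States that the direction of u + V u takes the value [w] exactly once. The map v -> t(v) w - v,
    with t(v) = [tsol w v], is Lipschitz with constant (2n + 2) + 1, and k = 1 / (2 (2n + 3)) makes
    its composite with [V] a contraction of ratio 1/2. *)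
Lemma sphere_near_id (n : nat) (V : 'rV[R]_n -> 'rV[R]_n) (w : 'rV[R]_n) (k : R) :
  k = (4 * n%:R + 6)^-1 -> enorm w = 1 ->
  (forall u, enorm u = 1 -> `|V u| <= k) ->
  (forall u u', enorm u = 1 -> enorm u' = 1 -> `|V u - V u'| <= k * `|u - u'|) ->
  exists u, [/\ enorm u = 1, (exists2 t, 0 < t & u + V u = t *: w) &
    forall u' t, enorm u' = 1 -> 0 < t -> u' + V u' = t *: w -> u' = u].
Proof.
move=> kE w1 Vk Vl.
have n0 : 0 <= n%:R :> R by [].
have d0 : 0 < 4 * n%:R + 6 :> R by lra.
have k0 : 0 < k by rewrite kE invr_gt0.
have Ek : (4 * n%:R + 6) * k = 1 by rewrite kE divff // gt_eqF.
have nk0 : 0 <= n%:R * k by rewrite mulr_ge0 // ltW.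
have nk : n%:R * k <= 4^-1 by lra.
have k1 : k <= 1 by lra.
(* Fixed points of T on the sphere are the solutions of u + V u = t w, t > 0. *)
pose T u := tsol w (V u) *: w - V u.
have TS : {homo T : u / unit_sphere u >-> unit_sphere u}.
  by move=> u; rewrite /unit_sphere /= => u1; apply: (tsol_enorm w1 k0 nk k1); exact: Vk.
have Tc : is_contraction (mkfun TS).
  have h0 : 0 <= 2^-1 :> R by rewrite invr_ge0.
  exists (NngNum h0); split => /=; first by lra.
  move=> [u u'] /= [u1 u'1]; rewrite /mkfun.
  have [_ tl _ _] := tsol_lipschitz w1 k0 nk k1 (Vk _ u1) (Vk _ u'1).
  have -> : T u - T u' = (tsol w (V u) - tsol w (V u')) *: w - (V u - V u').
    by rewrite /T; apply/rowP => i; rewrite !mxE; ring.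
  rewrite (le_trans (ler_normB _ _)) // normrZ.
  have w1' : `|w| <= 1 by rewrite -w1 norm_le_enorm.
  have vl := Vl _ _ u1 u'1.
  have : `|tsol w (V u) - tsol w (V u')| * `|w| <= (2 * n%:R + 2) * `|V u - V u'|.
    by rewrite -[leRHS]mulr1 ler_pM.
  have : (2 * n%:R + 3) * `|V u - V u'| <= (2 * n%:R + 3) * (k * `|u - u'|).
    by rewrite ler_wpM2l //; lra.
  have -> : (2 * n%:R + 3) * (k * `|u - u'|) = 2^-1 * ((4 * n%:R + 6) * k) * `|u - u'|.
    by field.
  by rewrite Ek; lra.
have S0 : (@unit_sphere R n) !=set0 by exists w.
have [u u1 Tu] := banach_fixed_point Tc (@closed_unit_sphere n) S0.
have uT : u = T u by [].
exists u; split=> //.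
  exists (tsol w (V u)); last by rewrite {1}uT /T subrK.
  by have [] := tsol_lipschitz w1 k0 nk k1 (Vk _ u1) (Vk _ u1).
move=> u' t u'1 t0 E.
have Et := tsol_uniq w1 k0 nk k1 (Vk _ u'1) u'1 t0 E.
have u'T : u' = T u' by rewrite /T -Et -E addrK.
exact: (contraction_fixpoint_unique Tc u'1 u1).
Qed.
End SphereNearId.

(** * Strict differentiability *)

Section StrictDiff.
Context {R : realType}.

(** Strict differentiability: both points vary, so that f - A is Lipschitz with a small constant on
    small balls. *)
Definition strict_diff (m n : nat) (f : 'rV[R]_m -> 'rV[R]_n) (p : 'rV[R]_m)
    (A : 'M[R]_(m, n)) :=
  forall e, 0 < e -> exists2 d, 0 < d & forall z z', `|z - p| < d -> `|z' - p| < d ->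
    `|f z - f z' - (z - z') *m A| <= e * `|z - z'|.

Lemma differentiable_eps (V W : normedModType R) (f : V -> W) (x : V) (e : R) :
  differentiable f x -> 0 < e ->
  exists2 d, 0 < d & forall h, `|h| < d -> `|f (h + x) - f x - 'd f x h| <= e * `|h|.
Proof.
move=> df e0; have := diff_locally df => /eqaddoP H0.
have /nbhs_ballP[d /= d0 H] := H0 _ e0; exists d => // h hd.
have := H h; rewrite -ball_normE /= sub0r normrN => /(_ hd).
by rewrite !fctE /= opprD addrA.
Qed.

Lemma eps_differentiable (m n : nat) (f : 'rV[R]_m -> 'rV[R]_n) (p : 'rV[R]_m) (A : 'M[R]_(m, n)) :
  (forall e, 0 < e -> exists2 d, 0 < d & forall h, `|h| < d ->
     `|f (h + p) - f p - h *m A| <= e * `|h|) ->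
  is_diff p f (fun v => v *m A).
Proof.
move=> H.
have cA : continuous (mulmxr A : {linear 'rV[R]_m -> 'rV[R]_n}).
  have [C C0 CA] := norm_mulmx_bound A.
  apply/linear_bounded_continuous/linear_boundedP.
  exists C; split=> [|r Cr x]; first exact: num_real.
  by apply: le_trans (CA x) _; rewrite ler_wpM2r // ltW.
have E : f \o shift p = cst (f p) + (mulmxr A : {linear 'rV[R]_m -> 'rV[R]_n}) +o_ (0 : 'rV[R]_m) id.
  apply/eqaddoP => e e0; have [d d0 dH] := H e e0.
  apply/nbhs_ballP; exists d => // h; rewrite -ball_normE /= sub0r normrN => hd.
  by have := dH h hd; rewrite !fctE /= opprD addrA.
have D := diff_unique cA E.
by apply: DiffDef => //; apply/diff_locallyP; rewrite D.
Qed.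

Lemma strict_is_diff (m n : nat) (f : 'rV[R]_m -> 'rV[R]_n) p A :
  strict_diff f p A -> is_diff p f (fun v => v *m A).
Proof.
move=> H; apply: eps_differentiable => e e0; have [d d0 dH] := H e e0.
exists d => // h hd; have := dH (h + p) p; rewrite addrK subrr normr0.
by apply.
Qed.

(** The two-point estimate between [z] and points tending to [z] passes to the derivative at [z]. *)
Lemma strict_jacobian (m n : nat) (f : 'rV[R]_m -> 'rV[R]_n) p A (e : R) :
  strict_diff f p A -> (\forall z \near p, differentiable f z) -> 0 < e ->
  exists2 d, 0 < d & forall z, `|z - p| < d ->
    differentiable f z /\ forall v : 'rV[R]_m, `|v *m (jacobian f z - A)| <= e * `|v|.
Proof.
move=> sf /nbhs_ballP[d1 /= d10 H1] e0.
have e20 : 0 < e / 2 by rewrite divr_gt0.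
have [d2 d20 H2] := sf _ e20.
exists (Num.min d1 d2) => [|z]; first by rewrite lt_min d10.
rewrite lt_min => /andP[zd1 zd2].
have dz : differentiable f z by apply: H1; rewrite -ball_normE /= distrC.
split=> // v.
have [d3 d30 H3] := differentiable_eps dz e20.
have [->|v0] := eqVneq v 0; first by rewrite mul0mx !normr0 mulr0.
have nv : 0 < `|v| by rewrite normr_gt0.
(* The vector [v] is scaled down until both the estimate at [z] and the strict estimate at [p]
   apply; the conclusion is homogeneous, so the factor [t] cancels. *)
pose d4 := Num.min d3 (d2 - `|z - p|).
have d40 : 0 < d4 by rewrite lt_min d30 subr_gt0.
pose t := d4 / 2 / `|v|.
have t0 : 0 < t by rewrite !divr_gt0.
have tv : `|t *: v| < d4.
  by rewrite normrZ gtr0_norm // divfK ?gt_eqF //; lra.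
rewrite lt_min in tv; case/andP: tv => tv3 tv4.
have {H3} := H3 _ tv3.
have {H2} := H2 (t *: v + z) z _ zd2.
have -> : `|t *: v + z - p| < d2.
  by rewrite -addrA (le_lt_trans (ler_normD _ _)) //; lra.
move=> /(_ isT); rewrite addrK => H2 H3.
have Ed : 'd f z (t *: v) = t *: v *m jacobian f z by rewrite /jacobian mul_rV_lin1.
rewrite Ed in H3.
have : `|t *: (v *m (jacobian f z - A))| <= e * `|t *: v|.
  rewrite (_ : t *: _ = (f (t *: v + z) - f z - t *: v *m A) - (f (t *: v + z) - f z - t *: v *m jacobian f z)); last first.
    by rewrite mulmxBr -!scalemxAl; apply/rowP => i; rewrite !mxE; ring.
  by rewrite (le_trans (ler_normB _ _)) //; lra.
by rewrite (normrZ t) (normrZ t) mulrCA ler_pM2l // normr_gt0 gt_eqF.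
Qed.

Lemma det_continuous (n : nat) : continuous (fun A : 'M[R]_n => \det A).
Proof.
rewrite /determinant; apply: continuous_big => [|s _ A]; first exact: add_continuous.
apply: (@continuousM _ _ (fun A : 'M[R]_n => _)); first exact: cst_continuous.
move: A; apply: continuous_big => [|i _ A]; first exact: mul_continuous.
exact: coord_continuous.
Qed.

Lemma sgz_det_near (n : nat) (A : 'M[R]_n) : \det A != 0 ->
  exists2 e, 0 < e & forall E : 'M[R]_n, (forall i j, `|E i j| <= e) ->
    sgz (\det (A + E)) = sgz (\det A).
Proof.
move=> d0; have := @det_continuous n A.
have dp : 0 < `|\det A| by rewrite normr_gt0.
move=> /cvgrPdist_lt /(_ _ dp) /nbhs_ballP[e /= e0 H].
exists (e / 2) => [|E EH]; first exact: divr_gt0.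
have := H (A + E); rewrite -ball_normE /= opprD addrA subrr sub0r normrN.
have Ee : `|E| < e.
  rewrite (@le_lt_trans _ _ (e / 2)) //; last lra.
  rewrite [leLHS]/Num.Def.normr /= mx_normrE; apply/bigmax_leP; split => [|[i j] _ /=].
    by rewrite divr_ge0 // ltW.
  exact: EH.
move=> /(_ Ee) {}H.
have [dA|dA|dA0] := ltgtP (\det A) 0; last by rewrite dA0 eqxx in d0.
  rewrite (ltr0_norm dA) ltr_norml in H; case/andP: H => H1 H2.
  by rewrite !ltr0_sgz //; lra.
rewrite (gtr0_norm dA) ltr_norml in H; case/andP: H => H1 H2.
by rewrite !gtr0_sgz //; lra.
Qed.
End StrictDiff.

(** * Local degree *)

Section LocalDegree.
Context {R : realType}.

(** Multiplied by the inverse of [A], the equation for the fibre over [y] says that u + V u is a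
    positive multiple of [y *m invmx A], where V u = H u A^-1 - u. *)
Lemma sphere_fiber_singleton (n : nat) (H : 'rV[R]_n -> 'rV[R]_n) (A : 'M[R]_n)
    (k : R) (y : 'rV[R]_n) :
  A \in unitmx -> k = (4 * n%:R + 6)^-1 ->
  (forall u, enorm u = 1 -> `|H u *m invmx A - u| <= k) ->
  (forall u u', enorm u = 1 -> enorm u' = 1 ->
    `|H u *m invmx A - u - (H u' *m invmx A - u')| <= k * `|u - u'|) ->
  enorm y = 1 ->
  exists u, sphere_fiber (fun u => (enorm (H u))^-1 *: H u) y = [set u].
Proof.
move=> Au kE Vk Vl y1; pose q := y *m invmx A.
have y0 : y != 0 by rewrite -enorm_gt0 y1.
have q0 : q != 0.
  apply: contraNneq y0 => q0; have := congr1 (mulmx^~ A) q0.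
  by rewrite mulmxKV // mul0mx => ->.
have eq0 : 0 < enorm q by rewrite enorm_gt0.
pose w := (enorm q)^-1 *: q.
have w1 : enorm w = 1.
  by rewrite enormZ gtr0_norm ?invr_gt0 // mulVf // gt_eqF.
have [u [u1 [t t0 Eu] uniq]] := sphere_near_id kE w1 Vk Vl.
rewrite addrC subrK in Eu.
exists u; apply/seteqP; split=> [v|_ ->] /=; last first.
  split => //; have Hu : H u = (t * (enorm q)^-1) *: y.
    have := congr1 (mulmx^~ A) Eu; rewrite mulmxKV // => ->.
    by rewrite /w -!scalemxAl mulmxKV // scalerA.
  rewrite Hu enormZ y1 mulr1 gtr0_norm ?scalerA; last by rewrite mulr_gt0 // invr_gt0.
  by rewrite mulVf ?scale1r // mulf_neq0 // ?invr_neq0 // gt_eqF.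
move=> [v1 Ev].
have Hv0 : H v != 0 by apply: contraNneq y0 => Hv; rewrite -Ev Hv scaler0.
have ev0 : 0 < enorm (H v) by rewrite enorm_gt0.
apply: (uniq v (enorm (H v) * enorm q)) => //; first exact: mulr_gt0.
rewrite addrC subrK /w scalerA mulfK ?gt_eqF // /q -Ev -scalemxAl scalerA.
by rewrite divff ?scale1r // gt_eqF.
Qed.

(** Since [s] is nonzero every point of the sphere is a regular value, and each sum has a single
    term. *)
Lemma sphere_degree_eq (n : nat) (f : 'rV[R]_n -> 'rV[R]_n) (s : int) :
  n != 0%N ->
  (forall y, unit_sphere y -> exists u, sphere_fiber f y = [set u]) ->
  (forall u, unit_sphere u -> unit_sphere (f u) -> sgz (sphere_jacdet f u) = s) ->
  s != 0 -> sphere_degree f = s.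
Proof.
move=> n0 ff fs s0; rewrite /sphere_degree (negbTE n0).
have sumE y : unit_sphere y -> \sum_(u \in sphere_fiber f y) sgz (sphere_jacdet f u) = s.
  move=> y1; have [u Eu] := ff y y1; rewrite Eu fsbig_set1.
  have [u1 fu] : sphere_fiber f y u by rewrite Eu.
  by apply: fs => //; rewrite fu.
have reg y : unit_sphere y -> regular_value f y.
  move=> y1; split=> // u [u1 fu]; rewrite -sgz_eq0 fs // fu //.
(* One regular value is needed for uniqueness: were there none, every integer would meet the
   condition that defines the degree. *)
have [y y1] : exists y : 'rV[R]_n, unit_sphere y.
  case: n n0 {f ff fs sumE reg} => // n _; pose e : 'rV[R]_n.+1 := const_mx 1.
  have e0 : 0 < enorm e.
    rewrite enorm_gt0; apply/eqP => /matrixP /(_ 0 0) /eqP.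
    by rewrite !mxE oner_eq0.
  exists ((enorm e)^-1 *: e); rewrite /unit_sphere /= enormZ gtr0_norm ?invr_gt0 //.
  by rewrite mulVf // gt_eqF.
apply: xget_unique => [z [z1 _]|k Hk]; first exact: sumE.
by rewrite -(Hk y (reg y y1)) sumE.
Qed.

(** Dividing by [r] does not alter directions, and u -> h (p + r u) / r differs from u -> u A by a
    map that is small and Lipschitz with a small constant; its Jacobian, corrected in the radial
    direction, is close to [A]. *)
Lemma local_degree (n : nat) (h : 'rV[R]_n -> 'rV[R]_n) (p : 'rV[R]_n) (A : 'M[R]_n) :
  \det A != 0 -> h p = 0 -> strict_diff h p A ->
  (\forall z \near p, differentiable h z) ->
  \forall r \near (0 : R)^'+,
    sphere_degree (fun u => (enorm (h (p + r *: u)))^-1 *: h (p + r *: u)) = sgz (\det A).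
Proof.
have [n0|n0] := eqVneq n 0%N.
  subst n => *; apply: nearW => r; by rewrite /sphere_degree eqxx det_mx00 sgz1.
move=> dA hp sh dh.
have Au : A \in unitmx by rewrite unitmxE unitfE.
have [C C0 HC] := norm_mulmx_bound (invmx A).
have [e e0 He] := sgz_det_near dA.
pose k : R := (4 * n%:R + 6)^-1.
have k0 : 0 < k by rewrite invr_gt0 ltr_wpDl // mulr_ge0.
(* The bound k / C makes the error small enough after multiplication by the inverse of [A]; e / 3
   serves the sign of the determinant, whose matrix differs from [A] by three errors of size
   [eps]. *)
pose eps := Num.min (k / C) (e / 3).
have eps0 : 0 < eps by rewrite lt_min !divr_gt0.
have epsC : C * eps <= k by rewrite mulrC -ler_pdivlMr // ge_min lexx.
have eps3 : 3 * eps <= e by rewrite mulrC -ler_pdivlMr // ge_min lexx orbT.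
have [d1 d10 H1] := sh _ eps0.
have [d2 d20 H2] := strict_jacobian sh dh eps0.
exists (Num.min d1 d2) => [|r /=]; first by rewrite /= lt_min d10.
rewrite sub0r normrN => rd r0; rewrite gtr0_norm // lt_min in rd.
case/andP: rd => rd1 rd2.
pose H u := h (p + r *: u).
have Su (u : 'rV[R]_n) : enorm u = 1 -> `|u| <= 1 by move=> <-; exact: norm_le_enorm.
have ru (u : 'rV[R]_n) : enorm u = 1 -> `|r *: u| <= r.
  by move=> u1; rewrite normrZ gtr0_norm // ger_pMr // Su.
have zp (u : 'rV[R]_n) : p + r *: u - p = r *: u by rewrite addrC addKr.
have h1 u : enorm u = 1 -> `|r^-1 *: H u - u *m A| <= eps.
  move=> u1; have := H1 (p + r *: u) p.
  rewrite zp subrr normr0 hp subr0 => /(_ (le_lt_trans (ru _ u1) rd1) d10) h1.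
  have -> : r^-1 *: H u - u *m A = r^-1 *: (h (p + r *: u) - r *: u *m A).
    by rewrite scalerBr -scalemxAl scalerA mulVf ?scale1r // gt_eqF.
  rewrite normrZ gtr0_norm ?invr_gt0 // mulrC ler_pdivrMr //.
  by rewrite (le_trans h1) // ler_wpM2l ?ru // ltW.
have h2 u u' : enorm u = 1 -> enorm u' = 1 ->
    `|r^-1 *: H u - u *m A - (r^-1 *: H u' - u' *m A)| <= eps * `|u - u'|.
  move=> u1 u'1; have := H1 (p + r *: u) (p + r *: u').
  rewrite !zp => /(_ (le_lt_trans (ru _ u1) rd1) (le_lt_trans (ru _ u'1) rd1)) h1'.
  have -> : r^-1 *: H u - u *m A - (r^-1 *: H u' - u' *m A) =
     r^-1 *: (h (p + r *: u) - h (p + r *: u') - (p + r *: u - (p + r *: u')) *m A).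
    have -> : p + r *: u - (p + r *: u') = r *: (u - u').
      by apply/rowP => i; rewrite !mxE; ring.
    rewrite -scalemxAl mulmxBl /H; apply/rowP => i; rewrite !mxE; field.
    by rewrite gt_eqF.
  rewrite normrZ gtr0_norm ?invr_gt0 // mulrC ler_pdivrMr //.
  apply: le_trans h1' _.
  have -> : p + r *: u - (p + r *: u') = r *: (u - u').
    by apply/rowP => i; rewrite !mxE; ring.
  by rewrite normrZ gtr0_norm // mulrCA mulrC.
have VE u : r^-1 *: H u *m invmx A - u = (r^-1 *: H u - u *m A) *m invmx A.
  by rewrite mulmxBl mulmxK.
have fE : (fun u => (enorm (h (p + r *: u)))^-1 *: h (p + r *: u)) =
    (fun u => (enorm (r^-1 *: H u))^-1 *: (r^-1 *: H u)).
  apply/funext => u; rewrite enormZ gtr0_norm ?invr_gt0 // invfM invrK scalerA.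
  by rewrite mulrAC divff ?mul1r // gt_eqF.
apply: sphere_degree_eq => //.
- move=> y y1; rewrite fE; apply: (sphere_fiber_singleton Au (erefl k)) => //.
    move=> u u1; rewrite VE; apply: le_trans (HC _) _; apply: le_trans _ epsC.
    by apply: ler_wpM2l; [exact: ltW|exact: h1].
  move=> u u' u1 u'1; rewrite !VE -mulmxBl; apply: le_trans (HC _) _.
  apply: (@le_trans _ _ (C * (eps * `|u - u'|))); last by rewrite mulrA ler_wpM2r.
  by apply: ler_wpM2l; [exact: ltW|exact: h2].
- move=> u u1 fu1.
  have Hu0 : H u != 0.
    apply/negP => /eqP Hu0; move: fu1; rewrite /unit_sphere /= -/(H u) Hu0 scaler0.
    by move/eqP; rewrite lt_eqF // /enorm big1 ?sqrtr0 // => i _; rewrite mxE expr0n.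
  have [dz Jz] := H2 (p + r *: u) (eq_ind_r (fun x => `|x| < d2) (le_lt_trans (ru _ u1) rd2) (zp u)).
  set J := jacobian h (p + r *: u) in Jz.
  have dH : is_diff u H (fun v => v *m (r *: J)).
    have dl : is_diff u (fun v => p + r *: v) (fun v => r *: v).
      have -> : (fun v => p + r *: v) = cst p + *:%R r by [].
      by apply: is_diff_eq; apply/funext => v; rewrite fctE add0r.
    apply: (is_diff_eq (is_diff_comp dl (is_diff_jacobian dz))).
    by apply/funext => v /=; rewrite -scalemxAr -scalemxAl.
  rewrite (sphere_jacdet_normalize u1 Hu0 dH).
  (* One error comes from [J - A], two from the rank-one term that corrects the radial direction. *)
  pose E := (J - A) + u^T *m ((r^-1 *: H u - u *m A) - u *m (J - A)).
  have -> : r *: J + u^T *m (H u - u *m (r *: J)) = r *: (A + E).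
    rewrite /E.
    have -> : r^-1 *: H u - u *m A - u *m (J - A) = r^-1 *: (H u - u *m (r *: J)).
      rewrite scalerBr mulmxBr -scalemxAr scalerA mulVf ?gt_eqF // scale1r.
      by rewrite opprB addrA subrK.
    rewrite -[u^T *m (r^-1 *: _)]scalemxAr; move: (u^T *m _) => X; move: (J) => Y; apply/matrixP => i j; rewrite !mxE; field.
    by rewrite gt_eqF.
  rewrite detZ sgzM gtr0_sgz ?invr_gt0 ?exprn_gt0 ?enorm_gt0 // mul1r.
  rewrite sgzM gtr0_sgz ?exprn_gt0 // mul1r He // => i j.
  have Jij (i' : 'I_n) : `|(J - A) i' j| <= eps.
    have := Jz (delta_mx 0 i'); rewrite -rowE => Ji.
    have := ler_coord_norm (row i' (J - A)) j; rewrite mxE => /le_trans; apply.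
    apply: le_trans Ji _; rewrite -[leRHS]mulr1; apply: ler_wpM2l; first exact: ltW.
    by apply: rV_norm_le => // l; rewrite !mxE; case: (_ && _); rewrite ?normr1 ?normr0.
  rewrite /E mxE (le_trans (ler_normD _ _)) // (le_trans _ eps3) //.
  have : `|(J - A) i j| <= eps by exact: Jij.
  suff : `|(u^T *m (r^-1 *: H u - u *m A - u *m (J - A))) i j| <= 2 * eps by lra.
  rewrite mxE big_ord1 normrM mxE -[leRHS]mul1r ler_pM //.
    by rewrite (le_trans (ler_coord_norm _ _)) // Su.
  rewrite (le_trans (ler_coord_norm _ _)) // (le_trans (ler_normB _ _)) //.
  have := h1 u u1; have := Jz u; have : eps * `|u| <= eps by rewrite ger_pMr // Su.
  by lra.
- by rewrite sgz_eq0.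
Qed.
End LocalDegree.

(** * Maps of class C^1 at a point *)

Section C1at.
Context {R : realType}.

(** A form of C^1 regularity at one point: it is what [local_degree] consumes, and it obeys a chain
    rule. *)
Definition C1at (m n : nat) (f : 'rV[R]_m -> 'rV[R]_n) (p : 'rV[R]_m) (A : 'M[R]_(m, n)) :=
  strict_diff f p A /\ \forall z \near p, differentiable f z.

Lemma near_ballP (m : nat) (p : 'rV[R]_m) (P : set 'rV[R]_m) :
  (\forall z \near p, P z) <-> exists2 d, 0 < d & forall z, `|z - p| < d -> P z.
Proof.
split=> [/nbhs_ballP[d /= d0 H]|[d d0 H]].
  by exists d => // z zd; apply: H; rewrite -ball_normE /= distrC.
by apply/nbhs_ballP; exists d => // z; rewrite -ball_normE /= distrC; exact: H.
Qed.

Lemma near_eq_differentiable (m n : nat) (f g : 'rV[R]_m -> 'rV[R]_n) (z : 'rV[R]_m) :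
  (\forall y \near z, f y = g y) -> differentiable f z -> differentiable g z.
Proof.
move=> /near_ballP[d d0 fg] df.
suff : is_diff z g (fun v => v *m jacobian f z) by move=> ?; exact: ex_diff.
apply: eps_differentiable => e e0; have [d' d'0 H] := differentiable_eps df e0.
exists (Num.min d d') => [|h]; first by rewrite lt_min d0.
rewrite lt_min => /andP[hd hd']; rewrite -!fg ?subrr ?normr0 ?addrK //.
by have := H h hd'; rewrite /jacobian mul_rV_lin1.
Qed.

Lemma C1at_near (m n : nat) (f g : 'rV[R]_m -> 'rV[R]_n) (p : 'rV[R]_m) A :
  (\forall y \near p, f y = g y) -> C1at f p A -> C1at g p A.
Proof.
move=> fg [sf df]; split.
  move=> e e0; have [d d0 H] := sf e e0; have /near_ballP[d' d'0 H'] := fg.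
  exists (Num.min d d') => [|z z']; first by rewrite lt_min d0.
  by rewrite !lt_min => /andP[zd zd'] /andP[z'd z'd']; rewrite -!H' // H.
apply: filterS (filterI df (nbhs_interior fg)) => z [dz fgz].
exact: (near_eq_differentiable fgz dz).
Qed.

Lemma norm_mulmx_le (m n : nat) (A : 'M[R]_(m, n)) (c : R) (v : 'rV[R]_m) : 0 <= c ->
  (forall i j, `|A i j| <= c) -> `|v *m A| <= m%:R * c * `|v|.
Proof.
move=> c0 Ac; apply: rV_norm_le => [|j]; first by rewrite !mulr_ge0.
rewrite mxE (le_trans (ler_norm_sum _ _ _)) // -mulrA mulr_natl -[X in _ *+ X]card_ord.
rewrite -sumr_const; apply: ler_sum => i _; rewrite normrM mulrC.
by apply: ler_pM => //; exact: ler_coord_norm.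
Qed.

Lemma strict_lipschitz (m n : nat) (f : 'rV[R]_m -> 'rV[R]_n) (p : 'rV[R]_m) A :
  strict_diff f p A -> exists2 C, 0 < C & exists2 d, 0 < d & forall z z',
    `|z - p| < d -> `|z' - p| < d -> `|f z - f z'| <= C * `|z - z'|.
Proof.
move=> sf; have [d d0 H] := sf 1 ltr01; have [C C0 HC] := norm_mulmx_bound A.
exists (1 + C); first by rewrite addr_gt0.
exists d => // z z' zd z'd; rewrite -[f z - f z'](subrK ((z - z') *m A)).
by rewrite (le_trans (ler_normD _ _)) // mulrDl lerD // H.
Qed.

(** The error of the composite is the error of [g] between f z and f z' plus the image under [B] of
    the error of [f]; a Lipschitz bound on [f] controls the first, which explains the shares e / 2 /
    Cf and e / 2 / CB. *)
Lemma C1at_comp (m n l : nat) (f : 'rV[R]_m -> 'rV[R]_n) (g : 'rV[R]_n -> 'rV[R]_l) p A B :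
  C1at f p A -> C1at g (f p) B -> C1at (g \o f) p (A *m B).
Proof.
move=> [sf df] [sg dg].
have [Cf Cf0 [df1 df10 Hf]] := strict_lipschitz sf.
have [CB CB0 HB] := norm_mulmx_bound B.
have small d : 0 < d -> exists2 d', 0 < d' & d' <= df1 /\
    forall z, `|z - p| < d' -> `|f z - f p| < d.
  move=> d0; exists (Num.min df1 (d / Cf)); first by rewrite lt_min df10 divr_gt0.
  split; first by rewrite ge_min lexx.
  move=> z; rewrite lt_min => /andP[zd zd'].
  rewrite (le_lt_trans (Hf z p zd _)) ?subrr ?normr0 //.
  by rewrite mulrC -ltr_pdivlMr.
split.
  move=> e e0.
  have e1 : 0 < e / 2 / Cf by rewrite !divr_gt0.
  have e2 : 0 < e / 2 / CB by rewrite !divr_gt0.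
  have [d1 d10 H1] := sg _ e1; have [d2 d20 H2] := sf _ e2.
  have [d3 d30 [d31 H3]] := small _ d10.
  exists (Num.min d2 d3) => [|z z']; first by rewrite lt_min d20.
  rewrite !lt_min => /andP[zd2 zd3] /andP[z'd2 z'd3].
  have -> : (g \o f) z - (g \o f) z' - (z - z') *m (A *m B) =
     (g (f z) - g (f z') - (f z - f z') *m B) + (f z - f z' - (z - z') *m A) *m B.
    by rewrite [((f z - f z') - _) *m B]mulmxBl mulmxA addrA subrK.
  rewrite (le_trans (ler_normD _ _)) // [e in e * _]splitr mulrDl lerD //.
    apply: le_trans (H1 _ _ (H3 _ zd3) (H3 _ z'd3)) _.
    rewrite -(ler_pM2l (_ : 0 < (e / 2 / Cf)^-1)) ?invr_gt0 //.
    rewrite mulrA mulVf ?gt_eqF // mul1r.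
    apply: le_trans (Hf z z' (lt_le_trans zd3 d31) (lt_le_trans z'd3 d31)) _.
    by rewrite mulrA; apply: ler_wpM2r => //; rewrite le_eqVlt; apply/orP; left; apply/eqP; field; rewrite !gt_eqF.
  apply: le_trans (HB _) _.
  have := H2 z z' zd2 z'd2; rewrite -(ler_pM2l CB0) => /le_trans; apply.
  by rewrite mulrA; apply: ler_wpM2r => //; rewrite le_eqVlt; apply/orP; left; apply/eqP; field; rewrite gt_eqF.
have /near_ballP[d d0 Hg] := dg; have [d' d'0 [_ H']] := small _ d0.
have nf : \forall z \near p, `|f z - f p| < d by apply/near_ballP; exists d'.
near=> z; apply: differentiable_comp; first by near: z.
by apply: Hg; near: z.
Unshelve. all: by end_near. Qed.

(** The mean value theorem on the segment from z' to z, which stays in the ball where the derivative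
    is close to the one at [p]. It is applied to each coordinate, as the intermediate point depends
    on it. *)
Lemma Ck1_C1at (m n : nat) (f : 'rV[R]_m -> 'rV[R]_n) (U : set 'rV[R]_m) p :
  (\forall z \near p, U z) -> Ck 1 U f -> C1at f p (jacobian f p).
Proof.
move=> nU [dU cU]; split; last by apply: filterS nU => z; exact: dU.
have Up : U p by apply: nbhs_singleton nU.
move=> e e0.
(* Closeness within e' on the m basis vectors gives operator norm at most m e' <= e; the 1 covers m
   = 0. *)
pose e' := e / (m%:R + 1).
have m0 : 0 <= m%:R :> R by [].
have e'0 : 0 < e' by rewrite divr_gt0 // ltr_wpDl.
have /near_ballP[d d0 H] : \forall z \near p, U z /\
    forall i : 'I_m, `|'d f z (delta_mx 0 i) - 'd f p (delta_mx 0 i)| < e'.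
  have nf (i : 'I_m) : \forall z \near p, `|'d f z (delta_mx 0 i) - 'd f p (delta_mx 0 i)| < e'.
    have /cvgrPdistC_lt := cU (delta_mx 0 i) p Up.
    exact.
  by apply: filterI => //; exact: (@filter_forall _ _ _ _ _ nf).
exists d => // z z' zd z'd.
have Hd y (v : 'rV[R]_m) : `|y - p| < d -> `|'d f y v - 'd f p v| <= e * `|v|.
  move=> /H[_ Hy].
  have vJ q : 'd f q v = v *m jacobian f q by rewrite /jacobian mul_rV_lin1.
  have -> : 'd f y v - 'd f p v = v *m (jacobian f y - jacobian f p).
    by rewrite mulmxBr; congr (_ - _); exact: vJ.
  apply: le_trans (norm_mulmx_le _ (ltW e'0) _) _.
    move=> i j; have := ler_coord_norm ('d f y (delta_mx 0 i) - 'd f p (delta_mx 0 i)) j.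
    by rewrite !mxE => /le_trans; apply; exact/ltW/Hy.
  apply: ler_wpM2r => //.
  by rewrite /e' mulrA ler_pdivrMr ?ltr_wpDl // mulrC ler_wpM2l ?ltW // ltrDl.
pose w := z - z'.
apply: rV_norm_le => [|j]; first by rewrite mulr_ge0 // ltW.
pose c (t : R) := z' + t *: w.
have cd (t : R) : 0 <= t <= 1 -> `|c t - p| < d.
  move=> /andP[t0 t1].
  have -> : c t - p = t *: (z - p) + (1 - t) *: (z' - p).
    by rewrite /c /w; apply/rowP => k; rewrite !mxE; ring.
  rewrite (le_lt_trans (ler_normD _ _)) // !normrZ (ger0_norm t0) ger0_norm ?subr_ge0 //.
  have [->|tn0] := eqVneq t 0; first by rewrite mul0r add0r subr0 mul1r.
  have t00 : 0 < t by rewrite lt_neqAle eq_sym tn0.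
  have h1 : t * `|z - p| < t * d by rewrite ltr_pM2l.
  have h2 : (1 - t) * `|z' - p| <= (1 - t) * d by rewrite ler_wpM2l ?subr_ge0 // ltW.
  by lra.
(* With the linear part subtracted, phi 1 - phi 0 is the j-th coordinate of the error to be
   bounded. *)
pose phi (t : R) : R := f (c t) 0 j - t * (w *m jacobian f p) 0 j.
pose dphi (t : R) : R := ('d f (c t) w - 'd f p w) 0 j.
have dp (t : R) : 0 <= t <= 1 -> is_derive t 1 phi (dphi t).
  move=> t01; have [Uc _] := H _ (cd t t01).
  have dc : is_diff t c (fun s : R => s *: w).
    apply: (is_diff_eq (is_diffD (is_diff_cst z' t) (is_diff_scalel t w))).
    by rewrite add0r.
  have dfc : is_diff t (fun t : R => f (c t) 0 j : R) (fun s : R => 'd f (c t) (s *: w) 0 j : R).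
    have d1 := is_diff_comp dc (differentiableP (dU _ Uc)).
    exact: (is_diff_comp d1 (is_diff_coord (f (c t)) j)).
  have d3 : is_derive t 1 (fun t : R => f (c t) 0 j : R) ('d f (c t) w 0 j).
    apply: DeriveDef; first by apply: diff_derivable; exact: ex_diff.
    by rewrite deriveE; [rewrite diff_val scale1r|exact: ex_diff].
  have -> : phi = (fun t : R => f (c t) 0 j : R) - ( (w *m jacobian f p) 0 j \*: id).
    by apply/funext => s; rewrite /phi !fctE /= mulrC.
  have -> : dphi t = 'd f (c t) w 0 j - (w *m jacobian f p) 0 j.
    by rewrite /dphi /jacobian mul_rV_lin1 mxE; congr (_ + _); rewrite mxE.
  apply: is_derive_eq; congr (_ - _).
  by rewrite -[LHS]/(_ * _) mulr1.
have phic : {within `[0, 1], continuous phi}.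
  apply: continuous_in_subspaceT => t; rewrite inE /= in_itv /= => t01.
  have := dp t t01 => H1; apply: differentiable_continuous; apply/derivable1_diffP.
  exact: ex_derive.
have [t] := MVT ltr01 (fun t (t01 : t \in `]0, 1[%R) => dp t (subset_itv_oo_cc t01)) phic.
rewrite in_itv /= => /andP[t0 t1]; rewrite subr0 mulr1 => E.
have -> : (f z - f z' - (z - z') *m jacobian f p) 0 j = dphi t.
  have c1 : c 1 = z by rewrite /c scale1r addrC subrK.
  have c0 : c 0 = z' by rewrite /c scale0r addr0.
  rewrite -E /phi c1 c0 mul1r mul0r subr0 -/w; move: (w *m _) => X.
  by rewrite !mxE; ring.
apply: le_trans (ler_coord_norm _ _) _; apply: Hd; apply: cd.
by rewrite !ltW.
Qed.

End C1at.

(** * Tangent maps and fixed points on the manifold *)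

Section Manifold.
Context {R : realType} {n : nat} {M : closedManifold R n}.

Definition local_rep (G : M -> M) (x : M) : 'rV[R]_n -> 'rV[R]_n :=
  chart_map (chart_at (G x)) \o G \o chart_inv (chart_at x).

Definition base_pt (x : M) : 'rV[R]_n := chart_map (chart_at x) x.

Lemma chart_at_dom (x : M) : chart_dom (chart_at x) x.
Proof. exact: s2valP' (cid2 (atlas_cover x)). Qed.

Lemma chart_at_atlas (x : M) : atlas (chart_at x).
Proof. exact: s2valP (cid2 (atlas_cover x)). Qed.

Lemma base_pt_img (x : M) : (chart_map (chart_at x) @` chart_dom (chart_at x)) (base_pt x).
Proof. by exists x => //; exact: chart_at_dom. Qed.

Lemma chart_inv_base_pt (x : M) : chart_inv (chart_at x) (base_pt x) = x.
Proof. by rewrite chart_mapK //; exact: chart_at_dom. Qed.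

(** Supplies a neighbourhood on which the local representative is meaningful, the coordinate maps
    having arbitrary values elsewhere. *)
Lemma near_base_pt (G : M -> M) (x : M) : continuous G ->
  \forall z \near base_pt x,
    (chart_map (chart_at x) @` (chart_dom (chart_at x) `&` G @^-1` chart_dom (chart_at (G x)))) z.
Proof.
move=> cG.
have cc : {for base_pt x, continuous (G \o chart_inv (chart_at x))}.
  apply: continuous_comp; first exact: chart_inv_continuous (base_pt_img x).
  exact: cG.
have n1 : \forall z \near base_pt x, chart_dom (chart_at (G x)) (G (chart_inv (chart_at x) z)).
  apply: cc; rewrite /= chart_inv_base_pt.
  apply: open_nbhs_nbhs; split; [exact: chart_dom_open|exact: chart_at_dom].
have n2 : \forall z \near base_pt x, (chart_map (chart_at x) @` chart_dom (chart_at x)) z.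
  by apply: open_nbhs_nbhs; split; [exact: chart_img_open|exact: base_pt_img].
apply: filterS (filterI n1 n2) => z [zG [y yd yz]].
by exists y => //; split=> //; rewrite -yz chart_mapK // in zG.
Qed.

(** Only preferred charts occur, so the intermediate chart of a composite is the same on both sides
    and the property passes to iterates without a change of charts. *)
Definition C1_at_points (G : M -> M) :=
  continuous G /\ forall x, C1at (local_rep G x) (base_pt x) (tangent_mx G x).

Lemma C1_map_at_points (G : M -> M) : C1_map G -> C1_at_points G.
Proof.
move=> [cG sG]; split=> // x.
exact: (Ck1_C1at (near_base_pt x cG) (sG _ _ (chart_at_atlas x) (chart_at_atlas (G x)))).
Qed.

Lemma C1at_tangent (G : M -> M) (x : M) A :
  C1at (local_rep G x) (base_pt x) A -> tangent_mx G x = A.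
Proof. by case=> /strict_is_diff dA _; exact: (jacobianE dA). Qed.

Lemma C1at_local_rep_comp (G H : M -> M) : C1_at_points G -> C1_at_points H ->
  forall x, C1at (local_rep (G \o H) x) (base_pt x) (tangent_mx H x *m tangent_mx G (H x)).
Proof.
move=> [cG sG] [cH sH] x.
have E : local_rep H x (base_pt x) = base_pt (H x).
  by rewrite /local_rep /= chart_inv_base_pt.
have sGH := sG (H x); rewrite -E in sGH.
apply: C1at_near (C1at_comp (sH x) sGH).
have := near_base_pt x cH; apply: filterS => z [y [yd Hyd] <-].
by rewrite /local_rep /= !chart_mapK.
Qed.

Lemma tangent_mx_comp (G H : M -> M) (x : M) : C1_at_points G -> C1_at_points H ->
  tangent_mx (G \o H) x = tangent_mx H x *m tangent_mx G (H x).
Proof. by move=> sG sH; apply: C1at_tangent; exact: C1at_local_rep_comp. Qed.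

Lemma C1_at_points_comp (G H : M -> M) : C1_at_points G -> C1_at_points H ->
  C1_at_points (G \o H).
Proof.
move=> sG sH; split=> [x|x].
  by apply: continuous_comp; [exact: sH.1|exact: sG.1].
by rewrite tangent_mx_comp //; exact: C1at_local_rep_comp.
Qed.

Lemma C1at_id (p : 'rV[R]_n) : C1at id p 1%:M.
Proof.
split; last by apply/near_ballP; exists 1 => // z _; exact: ex_diff.
move=> e e0; exists 1 => // z z' _ _.
by rewrite mulmx1 subrr normr0 mulr_ge0 // ltW.
Qed.

Lemma C1at_local_rep_id (x : M) : C1at (local_rep id x) (base_pt x) 1%:M.
Proof.
apply: C1at_near (C1at_id _).
have ci : continuous (id : M -> M) by move=> y; exact: cvg_id.
have := near_base_pt x ci; apply: filterS => z [y [yd _] <-].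
by rewrite /local_rep /= chart_mapK.
Qed.

Lemma tangent_mx_id (x : M) : tangent_mx id x = 1%:M.
Proof. exact/C1at_tangent/C1at_local_rep_id. Qed.

Lemma C1_at_points_iter (G : M -> M) k : C1_at_points G -> C1_at_points (iter k G).
Proof.
move=> sG; elim: k => [|k IH].
  split=> [y|x]; first exact: cvg_id.
  by rewrite (tangent_mx_id x); exact: C1at_local_rep_id.
exact: (C1_at_points_comp sG IH).
Qed.

(** At a fixed point the preferred charts of source and target coincide, so the local representative
    is the map used in the index. *)
Lemma C1at_displacement (G : M -> M) (x : M) : C1_at_points G -> G x = x ->
  C1at (fun z => z - (chart_map (chart_at x) \o G \o chart_inv (chart_at x)) z)
    (base_pt x) (1%:M - tangent_mx G x).
Proof.
move=> [_ /(_ x)]; rewrite /local_rep => + Gx; rewrite Gx; set g := _ \o _ => - [sg dg].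
split.
  2: by move: dg; apply: filterS => z dz; have iz : differentiable (id : 'rV[R]_n -> 'rV[R]_n) z by []; exact: (differentiableB iz dz).
move=> e e0; have [d d0 H] := sg e e0; exists d => // z z' zd z'd.
have -> : z - g z - (z' - g z') - (z - z') *m (1%:M - tangent_mx G x) =
    - (g z - g z' - (z - z') *m tangent_mx G x).
  by rewrite mulmxBr mulmx1; move: (_ *m _) => X; apply/rowP => i; rewrite !mxE; ring.
by rewrite normrN; exact: H.
Qed.

Lemma fixed_point_index_tangent (G : M -> M) (x : M) : C1_at_points G -> G x = x ->
  \det (1%:M - tangent_mx G x) != 0 ->
  fixed_point_index G x = sgz (\det (1%:M - tangent_mx G x)).
Proof.
move=> sG Gx d0; have [sh dh] := C1at_displacement sG Gx.
have h0 : base_pt x - (chart_map (chart_at x) \o G \o chart_inv (chart_at x)) (base_pt x) = 0.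
  by rewrite /= chart_inv_base_pt Gx subrr.
have near_deg := @local_degree _ _ (fun z => z - _ z) _ _ d0 h0 sh dh.
rewrite /fixed_point_index; apply: xget_unique => // k Hk.
(* Two values that both hold for all small r > 0 agree at some common radius. *)
by have [r [<- <-]] := filter_ex (filterI near_deg Hk).
Qed.

Lemma isolated_fixed_point (G : M -> M) (x : M) : C1_at_points G -> G x = x ->
  \det (1%:M - tangent_mx G x) != 0 ->
  \forall y \near x, G y = y -> y = x.
Proof.
move=> sG Gx d0; have [sh _] := C1at_displacement sG Gx.
set A := 1%:M - _ in d0 sh; set h := fun z => _ in sh.
have Au : A \in unitmx by rewrite unitmxE unitfE.
have h0 : h (base_pt x) = 0 by rewrite /h /= chart_inv_base_pt Gx subrr.
have [C C0 HC] := norm_mulmx_bound (invmx A).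
(* With this precision a zero z of the displacement satisfies |z - p| <= C |(z - p) A| <= |z - p| /
   2. *)
have e0 : 0 < (2 * C)^-1 by rewrite invr_gt0 mulr_gt0.
have [d d_gt0 Hd] := sh _ e0.
have hz z : `|z - base_pt x| < d -> h z = 0 -> z = base_pt x.
  move=> zd hz0; have := Hd z (base_pt x) zd; rewrite subrr normr0 h0 hz0 => /(_ d_gt0).
  rewrite subrr sub0r normrN => H1; apply/eqP; rewrite -subr_eq0 -normr_le0.
  have := HC ((z - base_pt x) *m A); rewrite mulmxK // => H2.
  have : C * `|(z - base_pt x) *m A| <= C * ((2 * C)^-1 * `|z - base_pt x|).
    by apply: ler_wpM2l => //; exact: ltW.
  have -> : C * ((2 * C)^-1 * `|z - base_pt x|) = 2^-1 * `|z - base_pt x|.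
    by field; rewrite gt_eqF.
  by lra.
have n1 : \forall y \near x, chart_dom (chart_at x) y.
  by apply: open_nbhs_nbhs; split; [exact: chart_dom_open|exact: chart_at_dom].
have n2 : \forall y \near x, `|chart_map (chart_at x) y - base_pt x| < d.
  by have /cvgrPdistC_lt := chart_map_continuous (chart_at_dom x); exact.
apply: filterS (filterI n1 n2) => y [yd yn] Gy.
have := hz _ yn; rewrite /h /= chart_mapK // Gy subrr => /(_ erefl) E.
by rewrite -(chart_inv_base_pt x) -E chart_mapK.
Qed.

(** Every point has a neighbourhood with no fixed point other than possibly itself: by isolation at
    fixed points, by separating x from G x elsewhere. Compactness leaves finitely many. *)
Lemma finite_Fix (G : M -> M) : C1_at_points G ->
  (forall x, G x = x -> \det (1%:M - tangent_mx G x) != 0) -> finite_set (Fix G).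
Proof.
move=> sG nd.
have isol x : \forall y \near x, G y = y -> y = x.
  have [Gx|Gx] := pselect (G x = x); first by apply: isolated_fixed_point => //; exact: nd.
  have := @manifold_hausdorff _ _ M; rewrite open_hausdorff => /(_ (G x) x) H.
  have [|[A B] /= [/set_mem GA /set_mem xB] [oA oB /eqP AB]] := H; first exact/eqP.
  have nA : \forall y \near x, A (G y) by apply: sG.1; apply: open_nbhs_nbhs.
  have nB : \forall y \near x, B y by apply: open_nbhs_nbhs.
  apply: filterS (filterI nA nB) => y [Ay By] Gy; exfalso.
  suff : (A `&` B) y by rewrite AB.
  by split=> //; rewrite -Gy.
pose f (x : M) := interior (fun y => G y = y -> y = x).
(* The covering form of compactness is applied to a pointed type, so an empty manifold is treated
   apart. *)
have [[x0 _]|M0] := pselect (exists x : M, True); last first.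
  by apply: (sub_finite_set _ (finite_set0 M)) => x _; apply: M0; exists x.
pose PM : ptopologicalType := HB.pack (manifold_carrier M) (isPointed.Build M x0).
have : @cover_compact PM [set: PM] by rewrite -compact_cover; exact: manifold_compact.
move=> /(_ M setT f).
case=> [x _|x _|D _ cD]; first exact: open_interior.
  by exists x => //; exact: isol.
apply: sub_finite_set (finite_fset D) => x Gx.
by have [y yD /interior_subset/(_ Gx) ->] := cD x I.
Qed.

End Manifold.

(** * Counting periodic points *)

Section Counting.

Lemma perm_divisors_mul (k m : nat) : (0 < k)%N -> (0 < m)%N ->
  perm_eq (seq.filter (dvdn m) (divisors (k * m))) (map (muln^~ m) (divisors k)).
Proof.
move=> k0 m0; apply: uniq_perm.
- by rewrite filter_uniq // divisors_uniq.
- rewrite map_inj_uniq ?divisors_uniq // => a b /eqP.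
  by rewrite eqn_pmul2r // => /eqP.
move=> d; rewrite mem_filter -dvdn_divisors ?muln_gt0 ?k0 //.
apply/andP/mapP => [[/dvdnP[e ->]]|[e]].
  by rewrite dvdn_pmul2r // => ek; exists e => //; rewrite -dvdn_divisors.
by rewrite -dvdn_divisors // => ek ->; rewrite dvdn_mull // dvdn_pmul2r.
Qed.

Lemma big_divisors_mul (V : nmodType) (k m : nat) (f : nat -> V) :
  (0 < k)%N -> (0 < m)%N ->
  \sum_(d <- divisors (k * m) | (m %| d)%N) f d = \sum_(e <- divisors k) f (e * m)%N.
Proof.
by move=> k0 m0; rewrite -big_filter (perm_big _ (perm_divisors_mul k0 m0)) big_map.
Qed.

(** Gauss's identity, read through the involution e -> k / e of the divisors. *)
Lemma sum_totient_divisors (k : nat) : (0 < k)%N ->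
  (\sum_(e <- divisors k) totient (k %/ e) = k)%N.
Proof.
move=> k0; have K a : (a %| k)%N -> (k %/ (k %/ a))%N = a.
  move=> ak; have ka0 : (0 < k %/ a)%N.
    by rewrite divn_gt0; [exact: dvdn_leq|exact: dvdn_gt0 ak].
  by rewrite -[X in (X %/ _)%N](divnK ak) mulKn.
have P : perm_eq (map (fun e => k %/ e)%N (divisors k)) (divisors k).
  apply: uniq_perm; rewrite ?divisors_uniq //.
    rewrite map_inj_in_uniq ?divisors_uniq // => a b.
    rewrite -!dvdn_divisors // => ak bk E.
    by rewrite -[a]K // E K.
  move=> d; rewrite -dvdn_divisors //; apply/mapP/idP => [[e]|dk].
    by rewrite -dvdn_divisors // => ek ->; exact: dvdn_div.
  by exists (k %/ d)%N; rewrite -?dvdn_divisors ?dvdn_div ?K.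
rewrite -[RHS]sum_totient_dvd -(big_map (fun e => k %/ e)%N xpredT totient) (perm_big _ P) /=.
rewrite -(big_mkord (fun d => d %| k)%N totient) -[RHS]big_filter; apply: perm_big.
apply: uniq_perm; rewrite ?divisors_uniq ?filter_uniq ?iota_uniq // => d.
rewrite mem_filter mem_index_iota -dvdn_divisors //= ltnS.
by case: (boolP (d %| k)%N) => //= dk; rewrite dvdn_leq.
Qed.

(** Even divisors are 2e with e a divisor of k / 2, and k / (2e) = (k / 2) / e: Gauss's identity for
    k / 2. *)
Lemma sum_totient_even (k : nat) : (0 < k)%N -> ~~ odd k ->
  (\sum_(e <- divisors k | ~~ odd e) totient (k %/ e) = k./2)%N.
Proof.
move=> k0 ke; have k2 : (k = k./2 * 2)%N by rewrite muln2 even_halfK.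
have k20 : (0 < k./2)%N by rewrite half_gt0; case: k k0 ke {k2} => [|[]].
rewrite {1 2}k2; under eq_bigl do rewrite -dvdn2.
rewrite (@big_divisors_mul nat) // -[RHS]sum_totient_divisors //.
by apply: eq_bigr => e _; rewrite divnMr.
Qed.

(** For even k the odd and the even divisors weigh k / 2 each, so they cancel when [eps] is -1; an
    odd k has no even divisors. *)
Lemma sum_totient_sign (k : nat) (s eps : int) : (0 < k)%N ->
  (~~ odd k -> eps = 1 \/ eps = -1) ->
  \sum_(e <- divisors k) (totient (k %/ e))%:Z * (if odd e then s else s * eps) =
  if ~~ odd k && (eps == -1) then 0 else k%:Z * s.
Proof.
move=> k0 He; rewrite (bigID odd) /=.
set o := \sum_(e <- _ | odd e) _; set v := \sum_(e <- _ | ~~ odd e) _.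
pose O := (\sum_(e <- divisors k | odd e) totient (k %/ e))%N.
pose E := (\sum_(e <- divisors k | ~~ odd e) totient (k %/ e))%N.
have Eo : o = O%:Z * s.
  by rewrite /o /O -natz natr_sum mulr_suml; apply: eq_bigr => e ->; rewrite natz.
have Ev : v = E%:Z * (s * eps).
  by rewrite /v /E -natz natr_sum mulr_suml; apply: eq_bigr => e /negbTE ->; rewrite natz.
have OE : (O + E = k)%N by rewrite -[RHS]sum_totient_divisors // [RHS](bigID odd).
have [ok|ek] := boolP (odd k) => /=.
  have E0 : E = 0%N.
    rewrite /E big1_seq // => e /andP[]; rewrite -dvdn_divisors // => /negP oe ek.
    by exfalso; apply: oe; exact: dvdn_odd ek ok.
  by rewrite Eo Ev E0 mul0r addr0 -OE E0 addn0.
have Ek : E = k./2 by exact: sum_totient_even.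
have k2 : (k = k./2 + k./2)%N by rewrite addnn even_halfK.
have Ok : O = k./2 by apply/eqP; rewrite -(eqn_add2r E) OE Ek -k2.
rewrite Eo Ev Ok Ek [in RHS]k2 PoszD.
by have [->|->] := He ek; rewrite ?eqxx /=; ring.
Qed.

End Counting.

(** * Minimal periods *)

Section Orbits.
Context {T : choiceType}.
Variable F : T -> T.

Lemma min_period_exists (k : nat) (x : T) : (0 < k)%N -> iter k F x = x ->
  exists t, is_min_period F x t.
Proof.
move=> k0 kx; have ex : exists m, (0 < m)%N && (iter m F x == x).
  by exists k; rewrite k0 kx eqxx.
case: (ex_minnP ex) => t /andP[t0 /eqP tx] tmin; exists t; split=> // m m0 mx.
by apply: tmin; rewrite m0 mx eqxx.
Qed.

Lemma iter_fix_mul (t q : nat) (x : T) : iter t F x = x -> iter (q * t) F x = x.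
Proof. by move=> tx; elim: q => // q IH; rewrite mulSn iterD IH. Qed.

Lemma min_periodP (t k : nat) (x : T) : is_min_period F x t ->
  reflect (iter k F x = x) (t %| k)%N.
Proof.
move=> [t0 tx tmin]; apply: (iffP dvdnP) => [[q ->]|kx]; first exact: iter_fix_mul.
apply/dvdnP; rewrite /dvdn; have [//|m0] := posnP (k %% t)%N.
have := ltn_pmod k t0; rewrite ltnNge => /negP []; apply: tmin => //.
have := kx; rewrite {1}(divn_eq k t) addnC iterD iter_fix_mul //.
Qed.

Lemma min_period_uniq (t t' : nat) (x : T) :
  is_min_period F x t -> is_min_period F x t' -> t = t'.
Proof.
move=> [t0 tx tm] [t'0 t'x t'm]; apply/eqP; rewrite eqn_leq.
by rewrite tm // t'm.
Qed.

Lemma min_period_iter (t i : nat) (x : T) :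
  is_min_period F x t -> is_min_period F (iter i F x) t.
Proof.
move=> tP; have [t0 tx tm] := tP; split=> // [|m m0 mx].
  by rewrite -iterD addnC iterD tx.
apply: tm => //; have : iter (m + i) F x = iter i F x by rewrite iterD.
(* The multiple i t of the period is at least i, so i t - i further steps bring F^i x back to x. *)
move=> /(congr1 (iter (i * t - i) F)); rewrite -!iterD.
have it : (i <= i * t)%N by rewrite leq_pmulr.
by rewrite addnCA subnK // iterD iter_fix_mul.
Qed.
End Orbits.

(** * Sums over orbits and over divisors *)

Section PeriodicOrbits.
Context {T : choiceType}.
Variables (F : T -> T) (k : nat).
Hypothesis k0 : (0 < k)%N.

Lemma iter_mod (t i : nat) (x : T) : iter t F x = x -> iter (i %% t) F x = iter i F x.
Proof. by move=> tx; rewrite [in RHS](divn_eq i t) addnC iterD iter_fix_mul. Qed.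

Lemma periodic_orbit_refl (x : T) : periodic_orbit F k x x.
Proof. by exists 0%N. Qed.

Lemma periodic_orbitE (t : nat) (x : T) : iter k F x = x -> is_min_period F x t ->
  periodic_orbit F k x = (fun i => iter i F x) @` `I_t.
Proof.
move=> kx tP; have [t0 tx tm] := tP; apply/seteqP; split=> [y [i ik <-]|y [i it <-]].
  by exists (i %% t)%N; [exact: ltn_pmod|exact: iter_mod].
exists i => //=; apply: leq_trans it _; apply: dvdn_leq => //.
exact/(min_periodP _ tP).
Qed.

Lemma periodic_orbit_inj (t : nat) (x : T) : is_min_period F x t ->
  set_inj `I_t (fun i => iter i F x).
Proof.
move=> tP i j; rewrite !inE /= => it jt E.
wlog ij : i j it jt E / (i <= j)%N.
  by move=> H; have [ij|/ltnW ji] := leqP i j; [exact: H|exact/esym/H].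
have : iter (j - i) F (iter i F x) = iter i F x by rewrite -iterD subnK.
move/(min_periodP _ (min_period_iter i tP)) => tji.
apply/eqP; rewrite eqn_leq ij /= -subn_eq0; apply: contraLR tji.
by rewrite -lt0n => ji; rewrite gtnNdvd // (leq_ltn_trans (leq_subr _ _)).
Qed.

Lemma periodic_orbit_eq (x y : T) : iter k F x = x -> periodic_orbit F k x y ->
  periodic_orbit F k y = periodic_orbit F k x.
Proof.
have sub u v : iter k F u = u -> periodic_orbit F k u v ->
    periodic_orbit F k v `<=` periodic_orbit F k u.
  move=> ku [i ik <-] _ [j jk <-]; exists ((j + i) %% k)%N; first exact: ltn_pmod.
  by rewrite iter_mod // iterD.
move=> kx xy; apply/seteqP; split; first exact: sub.
case: xy => i ik <-; apply: sub.
  by rewrite -iterD addnC iterD kx.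
(* The reduction modulo k matters for i = 0, where k - i is out of range. *)
exists ((k - i) %% k)%N; first exact: ltn_pmod.
rewrite iter_mod; last by rewrite -iterD addnC iterD kx.
by rewrite -iterD subnK // ltnW.
Qed.

(** Double counting of pairs of an orbit and a point on it: an orbit has [per x] points, and each
    carries the share k / per x of the factor k. *)
Lemma sum_periodic_orbits (P : set T) (per : T -> nat) (a : T -> int) (g : set T -> int) :
  finite_set P -> P `<=` Fix (iter k F) -> (forall x, P x -> P (F x)) ->
  (forall x, P x -> is_min_period F x (per x)) ->
  (forall x y, P x -> periodic_orbit F k x y -> a y = a x) ->
  (forall x, P x -> g (periodic_orbit F k x) = a x) ->
  k%:Z * \sum_(O \in periodic_orbit F k @` P) g O = \sum_(x \in P) (k %/ per x)%:Z * a x.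
Proof.
move=> Pfin PF PS perP aP gP.
have PI x i : P x -> P (iter i F x) by move=> Px; elim: i => //= i; exact: PS.
have Qfin : finite_set (periodic_orbit F k @` P) by exact: finite_image.
set c := fun x => (k %/ per x)%:Z * a x.
rewrite mulr_fsumr.
have -> : \sum_(O \in periodic_orbit F k @` P) k%:Z * g O =
    \sum_(O \in periodic_orbit F k @` P) \sum_(x \in P) (if x \in O then c x else 0).
  apply: eq_fsbigr => O; rewrite inE => -[x Px <-]; rewrite gP //.
  rewrite -fsbig_mkcondr (_ : P `&` _ = periodic_orbit F k x); last first.
    by apply/seteqP; split=> [y []//|y xy]; split=> //; case: xy => i _ <-; exact: PI.
  rewrite (periodic_orbitE (PF x Px) (perP x Px)) fsbig_image; last exact/periodic_orbit_inj/perP.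
  rewrite -(fsbig_ord _ _ (fun i => c (iter i F x))).
  rewrite (eq_bigr (fun => c x)) => [|i _].
    rewrite sumr_const card_ord /c -mulr_natl mulrA natz -PoszM mulnC divnK //.
    by apply/(min_periodP _ (perP x Px)); exact: PF.
  rewrite /c (aP x) //; last first.
    exists i => //=; apply: leq_trans (ltn_ord i) _; apply: dvdn_leq => //.
    by apply/(min_periodP _ (perP x Px)); exact: PF.
  by rewrite (min_period_uniq (perP _ (PI x i Px)) (min_period_iter i (perP x Px))).
rewrite exchange_fsbig //; apply: eq_fsbigr => x; rewrite inE => Px.
rewrite (eq_fsbigr (fun O : set T => if O \in [set O' | O' x] then c x else 0)); last first.
  by move=> O _; congr (if _ then _ else _); apply/idP/idP; rewrite !inE.
rewrite -fsbig_mkcondr (_ : _ `&` _ = [set periodic_orbit F k x]) ?fsbig_set1 //.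
apply/seteqP; split=> [_ [[y Py <-] /= yx]|_ ->].
  exact/esym/periodic_orbit_eq/yx/PF.
by split; [exists x|exact: periodic_orbit_refl].
Qed.

(** A point of minimal period t is fixed by F^d exactly when d = e t, and then k / d = (k / t) / e;
    the two sums are exchanged. *)
Lemma sum_divisors_fix (per : T -> nat) (ind : nat -> T -> int) :
  finite_set (Fix (iter k F)) ->
  (forall x, Fix (iter k F) x -> is_min_period F x (per x)) ->
  \sum_(d <- divisors k) (totient (k %/ d))%:Z * \sum_(x \in Fix (iter d F)) ind d x =
  \sum_(x \in Fix (iter k F)) \sum_(e <- divisors (k %/ per x))
     (totient (k %/ per x %/ e))%:Z * ind (e * per x)%N x.
Proof.
move=> Sfin perP; set S := Fix (iter k F).
have -> : \sum_(d <- divisors k) (totient (k %/ d))%:Z * \sum_(x \in Fix (iter d F)) ind d x =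
    \sum_(d <- divisors k) \sum_(x \in S)
      (if x \in Fix (iter d F) then (totient (k %/ d))%:Z * ind d x else 0).
  apply: eq_big_seq => d; rewrite -dvdn_divisors // => /dvdnP[q kq].
  rewrite mulr_fsumr -fsbig_mkcondr; apply: eq_fsbigl; apply/seteqP; split => [x dx|x []//].
  by split=> //; rewrite /S /Fix /= kq; exact: iter_fix_mul.
under eq_bigr do rewrite fsbig_finite //.
rewrite exchange_big fsbig_finite //=; apply: eq_big_seq => x.
rewrite in_fset_set // inE => Sx; have tP := perP x Sx; have [t0 _ _] := tP.
have tk : (per x %| k)%N by exact/(min_periodP _ tP).
rewrite -big_mkcond /= (eq_bigl (fun d => per x %| d)%N); last first.
  by move=> d; apply/idP/idP => [/set_mem/(min_periodP _ tP)//|/(min_periodP _ tP)/mem_set].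
have q0 : (0 < k %/ per x)%N by rewrite divn_gt0; [exact: dvdn_leq|].
rewrite -[in divisors k](divnK tk) (big_divisors_mul _ q0 t0).
by apply: eq_bigr => e _; rewrite [in LHS]mulnC divnMA mulnC.
Qed.
End PeriodicOrbits.

(** * The iterated index *)

Lemma eigenvalue_det (K : fieldType) (n : nat) (A : 'M[K]_n) (a : K) :
  eigenvalue A a = (\det (a%:M - A) == 0).
Proof. by rewrite eigenvalue_root_char rootE horner_char_poly. Qed.

(** The matrix 1 - A is a factor of 1 - A^m. This passes non-degeneracy from F^kappa down to F^d for
    d dividing kappa. *)
Lemma det_1BX_neq0 (K : fieldType) (n : nat) (A : 'M[K]_n) (m : nat) :
  \det (1%:M - A ^+ m) != 0 -> \det (1%:M - A) != 0.
Proof.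
apply: contraNneq => d0; have := subrX1 A m => /(congr1 determinant) E.
rewrite -opprB -scaleN1r detZ [X in _ * X]E det_mulmx -[A - 1]opprB -[- (1 - A)]scaleN1r detZ.
by rewrite d0 mulr0 mul0r mulr0.
Qed.

Lemma det_1submxC (K : comNzRingType) (m n : nat) (A : 'M[K]_(m, n)) (B : 'M[K]_(n, m)) :
  \det (1%:M - A *m B) = \det (1%:M - B *m A).
Proof. by rewrite -mulNmx det_1addmxC mulmxN. Qed.

Section IteratedIndex.
Context {R : realType} {n : nat} {M : closedManifold R n}.
Variables (F : M -> M) (k : nat).
Hypothesis k0 : (0 < k)%N.
Hypothesis sF : C1_at_points F.
Hypothesis nd : nondegenerate_map (iter k F).

Lemma iter_mul_fun (G : M -> M) e t : iter (e * t) G = iter e (iter t G).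
Proof.
elim: e => // e IH; apply/funext => x.
by rewrite mulSn iterD IH.
Qed.

Lemma tangent_mx_iter_fix (G : M -> M) x m : C1_at_points G -> G x = x ->
  tangent_mx (iter m G) x = tangent_mx G x ^+ m.
Proof.
move=> sG Gx; elim: m => [|m IH]; first exact: tangent_mx_id.
have -> : iter m.+1 G = G \o iter m G by [].
rewrite (tangent_mx_comp x sG (C1_at_points_iter m sG)).
by rewrite IH exprSr (_ : iter m G x = x) // -[m]muln1; exact: iter_fix_mul.
Qed.

(** F^t is F^(t-1) after F at x, and F after F^(t-1) at F x: the same two tangent matrices in
    opposite orders. *)
Lemma tangent_mx_shift (t : nat) (x : M) : (0 < t)%N -> iter t F x = x ->
  exists A B, tangent_mx (iter t F) (F x) = A *m B /\ tangent_mx (iter t F) x = B *m A.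
Proof.
move=> /prednK <-; move: (t.-1) => {}t tx; have st := C1_at_points_iter t sF.
have tFx : iter t F (F x) = x by rewrite -iterSr.
have E1 := tangent_mx_comp (F x) sF st; rewrite tFx in E1.
have E2 := tangent_mx_comp x st sF.
have Ef : iter t F \o F = iter t.+1 F by apply/funext => y; rewrite iterSr.
rewrite Ef in E2; rewrite -[F \o iter t F]/(iter t.+1 F) in E1.
by exists (tangent_mx (iter t F) (F x)), (tangent_mx F x).
Qed.

Lemma det_tangent_mx_neq0 (x : M) : iter k F x = x -> \det (1%:M - tangent_mx (iter k F) x) != 0.
Proof. by move=> kx; have := nd kx; rewrite eigenvalue_det. Qed.

Lemma finite_Fix_iter : finite_set (Fix (iter k F)).
Proof. by apply: finite_Fix (C1_at_points_iter k sF) _ => x; exact: det_tangent_mx_neq0. Qed.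

Lemma index_iter (t e : nat) (x : M) : iter k F x = x -> is_min_period F x t -> (e %| k %/ t)%N ->
  let B := tangent_mx (iter t F) x in
  fixed_point_index (iter (e * t) F) x =
    (if odd e then sgz (\det (1%:M - B)) else sgz (\det (1%:M - B)) * sgz (\det (1%:M + B)))
  /\ (~~ odd e -> \det (1%:M + B) != 0).
Proof.
move=> kx tP eq B; have [t0 tx _] := tP.
have tk : (t %| k)%N by exact/(min_periodP _ tP).
have st := C1_at_points_iter t sF.
have TB m : tangent_mx (iter (m * t) F) x = B ^+ m.
  by rewrite iter_mul_fun tangent_mx_iter_fix.
have dk : \det (1%:M - B ^+ e) != 0.
  apply: (@det_1BX_neq0 _ _ _ (k %/ t %/ e)); rewrite -exprM mulnC divnK //.
  by rewrite -TB divnK //; exact: det_tangent_mx_neq0.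
have := fixed_point_index_tangent (C1_at_points_iter (e * t) sF) (iter_fix_mul e tx).
rewrite TB => /(_ dk) ->.
have [oe|oe] := boolP (odd e); first by rewrite sgz_det_1B_odd.
by have [-> ?] := sgz_det_1B_even oe dk.
Qed.

(** Recasts oddness as a determinant sign, which is invariant along an orbit; for k / t even,
    [index_iter] with e = k / t provides the nonzero determinant. *)
Lemma bad_pointE (t : nat) (x : M) : iter k F x = x -> is_min_period F x t ->
  bad_point F k x <->
  ~~ odd (k %/ t) && (sgz (\det (1%:M + tangent_mx (iter t F) x)) == -1).
Proof.
move=> kx tP; have [_ H] := index_iter kx tP (dvdnn _).
have nb : ~~ odd (k %/ t) ->
    (sgz (\det (1%:M + tangent_mx (iter t F) x)) == -1) = odd (nb_eigenvalues_ltN1 (tangent_mx (iter t F) x)).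
  by move=> /H /sgz_det_1D ->; rewrite -signr_odd; case: (odd _).
split=> [[t' [t'P od ev]]|/andP[ev od]].
  by rewrite (min_period_uniq tP t'P) in nb *; rewrite ev nb.
by exists t; split => //; rewrite /odd_point -nb.
Qed.

Lemma good_point_shift (x : M) : iter k F x = x -> ~ bad_point F k x -> ~ bad_point F k (F x).
Proof.
move=> kx; have [t tP] := min_period_exists k0 kx.
have kFx : iter k F (F x) = F x by rewrite -iterSr iterS kx.
have [t0 tx _] := tP; have tFP := min_period_iter 1 tP.
rewrite (bad_pointE kx tP) (bad_pointE kFx tFP).
have [A [B [EF E]]] := tangent_mx_shift t0 tx.
by rewrite E [tangent_mx _ _]EF det_1addmxC.
Qed.

Lemma index_shift (x : M) : iter k F x = x ->
  fixed_point_index (iter k F) (F x) = fixed_point_index (iter k F) x.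
Proof.
move=> kx; have kFx : iter k F (F x) = F x by rewrite -iterSr iterS kx.
have sk := C1_at_points_iter k sF.
rewrite (fixed_point_index_tangent sk kFx (det_tangent_mx_neq0 kFx)).
rewrite (fixed_point_index_tangent sk kx (det_tangent_mx_neq0 kx)).
have [A [B [-> ->]]] := tangent_mx_shift k0 kx.
by rewrite det_1submxC.
Qed.

Lemma index_periodic_orbit (x y : M) : iter k F x = x -> periodic_orbit F k x y ->
  fixed_point_index (iter k F) y = fixed_point_index (iter k F) x.
Proof.
move=> kx [i _ <-]; elim: i => [|i IH]; first exact: erefl.
by rewrite iterS index_shift; [exact: IH|rewrite -iterD addnC iterD kx].
Qed.

Lemma orbit_indexE (x : M) : iter k F x = x ->
  orbit_index (iter k F) (periodic_orbit F k x) = fixed_point_index (iter k F) x.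
Proof.
move=> kx; rewrite /orbit_index; apply: xget_unique => [y|i Hi].
  exact: index_periodic_orbit.
by rewrite (Hi x) //; exact: periodic_orbit_refl.
Qed.

(** Both sides become sums over the points fixed by F^k and are compared point by point, in the
    integers. *)
Lemma iterated_index_mul :
  k%:Z * iterated_index F k =
  \sum_(d <- divisors k) (totient (k %/ d))%:Z * lefschetz (iter d F).
Proof.
pose S := Fix (iter k F); have Sfin : finite_set S := finite_Fix_iter.
pose per (x : M) := xget 0%N [set t | is_min_period F x t].
have perP x : S x -> is_min_period F x (per x).
  by move=> Sx; have [t tP] := min_period_exists k0 Sx; apply: (xgetPex 0%N); exists t.
pose P := S `&` [set x | ~ bad_point F k x].
have -> : iterated_index F k = \sum_(O \in periodic_orbit F k @` P) orbit_index (iter k F) O.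
  apply: eq_fsbigl; apply/seteqP; split=> [Q [x [Sx gx ->]]|Q [x [Sx gx] <-]]; first by exists x.
  by exists x.
rewrite (@sum_periodic_orbits _ F k k0 P per (fixed_point_index (iter k F))).
- rewrite (sum_divisors_fix k0 _ Sfin perP) /P fsbig_mkcondr; apply: eq_fsbigr => x.
  rewrite inE => Sx; have tP := perP x Sx; have [t0 tx _] := tP.
  have tk : (per x %| k)%N by exact/(min_periodP _ tP).
  have q0 : (0 < k %/ per x)%N by rewrite divn_gt0; [exact: dvdn_leq|].
  set B := tangent_mx (iter (per x) F) x.
  have [Ek /= e0] := index_iter Sx tP (dvdnn _).
  have bE := bad_pointE Sx tP.
  rewrite -/B in bE e0 Ek.
  have eps : ~~ odd (k %/ per x) -> sgz (\det (1%:M + B)) = 1 \/ sgz (\det (1%:M + B)) = -1.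
    by move=> /e0; case: sgzP => // _ _; [left|right].
  rewrite (eq_big_seq (fun e => (totient (k %/ per x %/ e))%:Z *
     (if odd e then sgz (\det (1%:M - B)) else sgz (\det (1%:M - B)) * sgz (\det (1%:M + B))))); last first.
    move=> e; rewrite -dvdn_divisors // => eq; congr (_ * _).
    by have [] := index_iter Sx tP eq.
  rewrite sum_totient_sign //.
  (* The condition is badness of x, and then both contributions are 0. For a good x with k / t even
     the sign of det (1 + B) is 1, so the index of F^k at x is the sign of det (1 - B), as for odd k
     / t. *)
  case: (boolP (_ && _)) => b.
    rewrite ifF //; apply/negP => /set_mem /=; apply; exact/bE.
  rewrite ifT; last by apply/mem_set => /= /bE; exact/negP.
  rewrite divnK // in Ek; rewrite Ek; case: ifPn => // oe.
  have [->|E] := eps oe; first by rewrite mulr1.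
  by rewrite oe E eqxx in b.
- exact: finite_setIl.
- by move=> x [].
- move=> x [Sx gx]; split; last exact: good_point_shift.
  by rewrite /S /Fix /= -iterSr iterS Sx.
- by move=> x [Sx _]; exact: perP.
- by move=> x y [Sx _]; exact: index_periodic_orbit.
- by move=> x [Sx _]; exact: orbit_indexE.
Qed.
End IteratedIndex.

Theorem theorem2p2 (R : realType) (n : nat) (M : closedManifold R n)
    (F : M -> M) (kappa : nat)
    (kappa_gt0 : (0 < kappa)%N)
    (F_C1 : C1_map F)
    (F_nondeg : nondegenerate_map (iter kappa F)) :
  (iterated_index F kappa)%:~R =
    kappa%:R^-1 * (\sum_(d <- divisors kappa)
      (totient (kappa %/ d)%N)%:R * (lefschetz (iter d F))%:~R) :> rat.
Proof.
have k0 : kappa%:R != 0 :> rat by rewrite pnatr_eq0 -lt0n.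
apply: (mulfI k0); rewrite mulVKf //.
have := iterated_index_mul kappa_gt0 (C1_map_at_points F_C1) F_nondeg.
move/(congr1 (intr : int -> rat)); rewrite rmorphM /= => ->.
rewrite rmorph_sum /=; apply: eq_bigr => d _; rewrite rmorphM //.
Qed.
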